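(* Let $n\ge2$ be an integer, $\alpha>0$, $\tau=2\pi/n$, and identify $\mathbb{R}^2$ with $\mathbb{C}$, with complex unit $J$. Let $$\Lambda=\{y\in H^1_{2\pi}(\mathbb{R},\mathbb{C}): y(t)\ne y(t+h\tau)\ \text{for all } t\in\mathbb{R},\ h=1,\dots,n-1\}$$ and, for $\omega>0$ and $y\in\Lambda$, $$\mathcal{A}(y)=\frac12\int_0^{2\pi}|\dot y(t)+J\omega y(t)|^2\,dt+\frac12\sum_{h=1}^{n-1}\int_0^{2\pi}\frac{dt}{|y(t)-y(t+h\tau)|^\alpha}.$$ For $\omega>0$ let $h(\omega)$ denote the positive integer $m$ at which $\min_{m\in\mathbb{N},\,m\geq 1}\frac{(\omega-m)^2}{m^2}$ is attained (the smallest such $m$ in case of a tie), and let $\omega^*=\max\{\omega>0: h(\omega)=1\}$. If $\omega\in(0,\omega^* )\setminus\{1\}$, then $\mathcal{A}$ attains its minimum on $\Lambda$ on a circle with minimal period $2\pi$ and with radius depending on $n$, $\alpha$ and $\omega$.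
   Context: $H^1_{2\pi}(\mathbb{R},\mathbb{C})$ is the space of $2\pi$-periodic functions that are locally in the Sobolev class $H^1$. $\mathcal{A}$ is the Lagrangian action of $n$ equal unit masses $y_i(t)=y(t+i\tau)$, $i=0,\dots,n-1$, in a frame rotating with angular velocity $\omega$ (orbits in the inertial frame and in the rotating frame are related by $x(t)=e^{J\omega t}y(t)$). A circle is a loop traversing a round circle with constant speed. Numerically $\omega^*\cong 1.3333$. *)

(* Defs.v *)
From HB Require Import structures.
From mathcomp Require Import all_boot all_order all_algebra.
From mathcomp Require Import complex.
From mathcomp Require Import all_classical all_reals all_analysis.

Set Implicit Arguments.
Unset Strict Implicit.
Unset Printing Implicit Defensive.

Import Order.TTheory GRing.Theory Num.Theory.
Import numFieldNormedType.Exports.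
Import complex.ComplexField.Normc.

#[global] Open Scope classical_set_scope.
#[global] Open Scope ring_scope.

(* The plane is [R[i]], the complex unit J is ['i%C], and the real-valued
   modulus |z| is [normc z]. *)

Definition expi {R : realType} (t : R) : R[i] := (cos t +i* sin t)%C.

Definition periodic_with {R : realType} (T : R) (y : R -> R[i]) : Prop :=
  forall t, y (t + T) = y t.

Definition minimal_period {R : realType} (T : R) (y : R -> R[i]) : Prop :=
  [/\ 0 < T, periodic_with T y &
      forall S : R, 0 < S -> periodic_with S y -> T <= S].

(* Weak derivatives are tested against C^1_c(R), as is usual in dimension one;
   this yields the same weak derivatives as testing against C^infty_c(R). *)
Definition C1c {R : realType} (phi : R -> R) : Prop :=
  [/\ forall x, derivable phi x 1, continuous (derive1 phi) &
      compact (closure [set x | phi x != 0])].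

Definition L1loc {R : realType} (f : R -> R[i]) : Prop :=
  locally_integrable setT (fun t => complex.Re (f t)) /\
  locally_integrable setT (fun t => complex.Im (f t)).

Definition L2loc {R : realType} (f : R -> R[i]) : Prop :=
  [/\ measurable_fun setT (fun t => complex.Re (f t)),
      measurable_fun setT (fun t => complex.Im (f t)) &
      locally_integrable setT (fun t => normc (f t) ^+ 2)].

Definition is_weak_derivative_real {R : realType} (f g : R -> R) : Prop :=
  forall phi : R -> R, C1c phi ->
    \int[lebesgue_measure]_t (f t * derive1 phi t) =
    - \int[lebesgue_measure]_t (g t * phi t).

Definition is_weak_derivative {R : realType} (y v : R -> R[i]) : Prop :=
  [/\ L1loc v,
      is_weak_derivative_real (fun t => complex.Re (y t)) (fun t => complex.Re (v t)) &
      is_weak_derivative_real (fun t => complex.Im (y t)) (fun t => complex.Im (v t))].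

(* A choice of weak derivative; it is determined up to a Lebesgue-null set. *)
Definition weak_derivative {R : realType} (y : R -> R[i]) : R -> R[i] :=
  xget (fun=> 0) [set v | is_weak_derivative y v].

(* Elements of H^1 are identified with their continuous representatives, so
   that the pointwise non-collision condition in [Lambda] makes sense. *)
Definition H1_2pi {R : realType} (y : R -> R[i]) : Prop :=
  [/\ continuous (fun t => complex.Re (y t)), continuous (fun t => complex.Im (y t)),
      periodic_with (2 * pi) y, L2loc y &
      exists2 v, is_weak_derivative y v & L2loc v].

Definition tau {R : realType} (n : nat) : R := 2 * pi / n%:R.

Definition Lambda {R : realType} (n : nat) : set (R -> R[i]) :=
  [set y | H1_2pi y /\
    forall (t : R) (h : nat), (1 <= h < n)%N -> y t <> y (t + h%:R * tau n)].

Definition action {R : realType} (n : nat) (alpha omega : R)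
    (y : R -> R[i]) : \bar R :=
  ((2^-1)%:E *
     \int[lebesgue_measure]_(t in `[0%R, (2 * pi)%R])
       (normc (weak_derivative y t + 'i%C * (omega%:C)%C * y t) ^+ 2)%:E
   + (2^-1)%:E *
     \sum_(1 <= h < n)
       \int[lebesgue_measure]_(t in `[0%R, (2 * pi)%R])
         (1 / (normc (y t - y (t + h%:R * tau n)) `^ alpha))%:E)%E.

(* Round circle of radius [r] and arbitrary centre, traversed at constant
   angular speed [k] of either sign. *)
Definition is_circle {R : realType} (r : R) (y : R -> R[i]) : Prop :=
  0 < r /\ exists (c : R[i]) (k theta : R), k != 0 /\
    forall t, y t = c + (r%:C)%C * expi (k * t + theta).

Definition hratio {R : realType} (omega : R) (m : nat) : R :=
  (omega - m%:R) ^+ 2 / m%:R ^+ 2.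

Definition is_argmin {R : realType} (omega : R) (m : nat) : Prop :=
  (1 <= m)%N /\ forall k, (1 <= k)%N -> hratio omega m <= hratio omega k.

(* [h(omega)]: the minimum over [m >= 1] is always attained, so the default
   value 0 is never returned for [omega > 0]. *)
Definition hmin {R : realType} (omega : R) : nat :=
  xget 0%N
    [set m | is_argmin omega m /\ forall k, is_argmin omega k -> (m <= k)%N].

Definition is_max {R : realType} (A : set R) (w : R) : Prop :=
  A w /\ ubound A w.

(* The maximum exists (it equals 4/3), so the default value is not used. *)
Definition omega_star {R : realType} : R :=
  xget 0 [set w | is_max [set v : R | 0 < v /\ hmin v = 1%N] w].

(* Main.v *)
Require Import Defs.
From mathcomp Require Import all_boot all_order all_algebra.
From mathcomp Require Import complex ring lra.
From mathcomp Require Import all_classical all_reals all_analysis measurable_realfun.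

Set Implicit Arguments.
Unset Strict Implicit.
Unset Printing Implicit Defensive.

Import Order.TTheory GRing.Theory Num.Theory.
Import numFieldNormedType.Exports.
Import complex.ComplexField.Normc.

Local Open Scope classical_set_scope.
Local Open Scope ring_scope.

(** Write a loop as z(t) = sum_j c_j e^(ijt) and let E be the integral of |z'|^2 over
    a period, that is 2 pi times the sum of j^2 |c_j|^2.  Three estimates bound the
    action from below in terms of E alone.

    - Kinetic part.  The integral of |z' + i omega z|^2 is 2 pi times the sum of
      (j + omega)^2 |c_j|^2, and it is at least (omega - 1)^2 E: among the integers
      j <> 0 the ratio (j + omega)^2 / j^2 is smallest at j = -1 as long as
      omega <= 4/3 ([kinetic_bound], [le_of_lt_omega_star]).
    - Chords.  The integral of |z(t + h tau) - z(t)|^2 is 2 pi times the sum of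
      4 sin^2(j h pi/n) |c_j|^2, and it is at most 4 sin^2(h pi/n) E
      ([chord_inequality]).
    - Potential.  The convex function s^(-alpha/2) lies above its tangent at the
      squared chord of the regular n-gon of radius r ([potential_ge]).

    The sum of these bounds is affine in E.  For the radius r given by
    [critical_radius] its slope is 0, because (omega - 1)^2 r^2 equals alpha/2 times
    the potential of the n-gon ([critical_radiusP]); so the action of every loop is at
    least a constant ([action_ge]).  The loop r e^(-it) has only the mode j = -1 and
    constant chords; it turns all three estimates into equalities, and its action is
    this constant ([action_circle]).

    The two spectral inequalities are proved without Fourier series on the circle.
    Both are first shown for sequences on a cycle of N points: the discrete Wirtinger
    inequality by the discrete Fourier transform, the chord inequality from it by a
    Sturm comparison ([discrete_wirtinger], [discrete_chord]).  A loop is sampled on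
    all the grids of step 2 pi/N; averaging over the grids turns sums into integrals,
    and N tends to infinity.  The only information on the loop that this uses is
    (f b - f a)^2 <= (b - a) times the integral of f'^2 on [a, b], which follows from
    the fundamental theorem of calculus for weak derivatives ([weak_FTC]).  The
    kinetic bound is a combination of two Wirtinger inequalities, for the
    antiperiodic loops e^(it/2) z and e^(3it/2) z. *)

(** * Discrete Fourier analysis on a cycle *)

Lemma sum_periodic_shift (V : zmodType) (N m : nat) (y : nat -> V) :
  (forall j, y (j + N)%N = y j) -> \sum_(j < N) y (j + m)%N = \sum_(j < N) y j.
Proof.
move=> yN; elim: m => [|m <-]; first by apply: eq_bigr => i _; rewrite addn0.
rewrite -(big_mkord xpredT (fun j => y (j + m)%N)).
case: N yN => [|N] yN; first by rewrite !big_ord0 big_nil.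
rewrite big_ord_recr /= [RHS]big_nat_recl //= big_mkord add0n addrC.
have -> : (N + m.+1 = m + N.+1)%N by rewrite addnS addnC addnS.
rewrite yN; congr (_ + _); apply: eq_bigr => i _; by rewrite addnS.
Qed.

(** Multiplied by 2 sin(phi/2), the sum telescopes; this factor is nonzero because
    0 < p < M. *)
Lemma sum_cos_eq0 (R : realType) (M p : nat) : (0 < p < M)%N ->
  \sum_(k < M) cos (k%:R * (2 * pi / M%:R * p%:R)) = 0 :> R.
Proof.
move=> /andP[p0 pM]; set phi : R := 2 * pi / M%:R * p%:R.
have M0 : 0 < M%:R :> R by rewrite ltr0n (leq_trans p0 (ltnW pM)).
have s0 : sin (phi / 2) != 0.
  rewrite gt_eqF// sin_gt0_pi// /phi.
  have -> : 2 * pi / M%:R * p%:R / 2 = pi * (p%:R / M%:R) :> R by field; lra.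
  rewrite mulr_gt0 ?pi_gt0 ?divr_gt0 ?ltr0n ?(leq_trans p0 (ltnW pM))//=.
  by rewrite gtr_pMr ?pi_gt0// ltr_pdivrMr// mul1r ltr_nat.
have ne : 2 * sin (phi / 2) != 0.
  by rewrite mulf_eq0 negb_or s0 pnatr_eq0.
apply: (mulfI ne); rewrite mulr0.
have tel n : 2 * sin (phi / 2) * \sum_(k < n) cos (k%:R * phi) =
    sin (n%:R * phi - phi / 2) + sin (phi / 2).
  elim: n => [|n IH]; first by rewrite big_ord0 mulr0 mul0r sub0r sinN addNr.
  rewrite big_ord_recr /= mulrDr IH.
  have -> : n.+1%:R * phi - phi / 2 = n%:R * phi + phi / 2.
    by rewrite -natr1; field.
  rewrite sinB sinD; ring.
rewrite tel.
have -> : M%:R * phi - phi / 2 = - (phi / 2) + pi *+ 2 *+ p.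
  rewrite /phi -mulrnA -[pi *+ _]mulr_natr natrM; field; lra.
by rewrite (periodicn (@sinD2pi R)) sinN addNr.
Qed.

(** Expanding the squares leaves sums over k of cos(k theta (j - l)), which vanish
    off the diagonal j = l. *)
Lemma discrete_parseval (R : realType) (M : nat) (y : nat -> R) :
  (0 < M)%N ->
  \sum_(k < M) ((\sum_(j < M) y j * cos (k%:R * (2 * pi / M%:R * j%:R))) ^+ 2 +
                (\sum_(j < M) y j * sin (k%:R * (2 * pi / M%:R * j%:R))) ^+ 2)
  = M%:R * \sum_(j < M) y j ^+ 2.
Proof.
move=> M0; set th : R := 2 * pi / M%:R.
transitivity (\sum_(k < M) \sum_(j < M) \sum_(l < M)
    y j * y l * cos (k%:R * (th * j%:R) - k%:R * (th * l%:R))).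
  apply: eq_bigr => k _; rewrite !expr2 !big_distrlr /= -big_split /=.
  apply: eq_bigr => j _; rewrite -big_split /=; apply: eq_bigr => l _.
  rewrite cosB; ring.
rewrite exchange_big mulr_sumr /=; apply: eq_bigr => j _.
rewrite exchange_big (bigD1 j) //= [X in _ + X]big1 ?addr0; last first.
  move=> l lj; rewrite -mulr_sumr.
  case: (ltngtP l j) lj => [lj _|jl _|/val_inj->]; last by rewrite eqxx.
  - under eq_bigr do rewrite -!mulrBr -natrB ?(ltnW lj)//.
    by rewrite sum_cos_eq0 ?mulr0// subn_gt0 lj (leq_ltn_trans (leq_subr _ _)).
  - under eq_bigr do rewrite -cosN opprB -!mulrBr -natrB ?(ltnW jl)//.
    by rewrite sum_cos_eq0 ?mulr0// subn_gt0 jl (leq_ltn_trans (leq_subr _ _)).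
under eq_bigr do rewrite subrr cos0 mulr1.
by rewrite sumr_const card_ord -[LHS]mulr_natl expr2.
Qed.

(** Taking differences multiplies the squared modulus of the k-th Fourier mode by
    2 - 2 cos(2 pi k/M).  Mode 0 is absent because the sum of y is 0, and on the
    other modes this factor is smallest at k = 1 and k = M - 1. *)
Lemma discrete_wirtinger (R : realType) (M : nat) (y : nat -> R) :
  (0 < M)%N -> (forall j, y (j + M)%N = y j) -> \sum_(j < M) y j = 0 ->
  4 * sin (pi / M%:R) ^+ 2 * \sum_(j < M) y j ^+ 2
    <= \sum_(j < M) (y j.+1 - y j) ^+ 2.
Proof.
move=> M0 yM y0; have MR : 0 < M%:R :> R by rewrite ltr0n.
rewrite -(ler_pM2l MR) mulrCA.
rewrite -(discrete_parseval y M0) -(discrete_parseval (fun j => y j.+1 - y j) M0).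
rewrite mulr_sumr; apply: ler_sum => k _.
set th : R := 2 * pi / M%:R; set a := k%:R * th.
have arg (j : nat) : k%:R * (th * j%:R) = a * j%:R by rewrite mulrA.
under eq_bigr do rewrite arg.
under [X in _ * (_ + X ^+ 2)]eq_bigr do rewrite arg.
under [X in _ <= X ^+ 2 + _]eq_bigr do rewrite arg mulrBl.
under [X in _ <= _ + X ^+ 2]eq_bigr do rewrite arg mulrBl.
rewrite !sumrB.
set C := \sum_(j < M) y j * cos _; set S := \sum_(j < M) y j * sin _.
have per (j : nat) : a * (j + M)%:R = a * j%:R + pi *+ 2 *+ k.
  rewrite natrD mulrDr; congr (_ + _).
  by rewrite /a /th -mulrnA -[pi *+ _]mulr_natr natrM; field; lra.
have shC : \sum_(j < M) y j.+1 * cos (a * j%:R) = cos a * C + sin a * S.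
  rewrite /C /S -(sum_periodic_shift 1 (y := fun j => y j * cos (a * j%:R))); last first.
    by move=> j; rewrite yM per (periodicn (@cosD2pi R)).
  rewrite -(sum_periodic_shift 1 (y := fun j => y j * sin (a * j%:R))); last first.
    by move=> j; rewrite yM per (periodicn (@sinD2pi R)).
  rewrite !mulr_sumr -big_split; apply: eq_bigr => j _ /=.
  rewrite addn1.
  have -> : a * j%:R = a * j.+1%:R - a by rewrite -natr1 mulrDr mulr1 addrK.
  rewrite cosB; ring.
have shS : \sum_(j < M) y j.+1 * sin (a * j%:R) = cos a * S - sin a * C.
  rewrite /C /S -(sum_periodic_shift 1 (y := fun j => y j * cos (a * j%:R))); last first.
    by move=> j; rewrite yM per (periodicn (@cosD2pi R)).
  rewrite -(sum_periodic_shift 1 (y := fun j => y j * sin (a * j%:R))); last first.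
    by move=> j; rewrite yM per (periodicn (@sinD2pi R)).
  rewrite !mulr_sumr -sumrB; apply: eq_bigr => j _ /=.
  rewrite addn1.
  have -> : a * j%:R = a * j.+1%:R - a by rewrite -natr1 mulrDr mulr1 addrK.
  rewrite sinB; ring.
rewrite shC shS.
have -> : (cos a * C + sin a * S - C) ^+ 2 + (cos a * S - sin a * C - S) ^+ 2
    = (2 - 2 * cos a) * (C ^+ 2 + S ^+ 2).
  by have := sin2cos2 a; set c := cos a; set s := sin a => cs; ring: cs.
have [k0|k0] := posnP k.
  have -> : a = 0 by rewrite /a k0 mul0r.
  have -> : C = 0.
    rewrite /C /a k0 mul0r -[RHS]y0; apply: eq_bigr => j _.
    by rewrite mul0r cos0 mulr1.
  have -> : S = 0.
    rewrite /S /a k0 mul0r big1// => j _; by rewrite mul0r sin0 mulr0.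
  by rewrite expr0n /= addr0 !mulr0.
apply: ler_wpM2r; first by rewrite addr_ge0// sqr_ge0.
have -> : a = (pi / M%:R * k%:R) *+ 2 by rewrite /a /th -mulr_natr; field; lra.
rewrite cos_mulr2n cos2sin2.
suff : sin (pi / M%:R) ^+ 2 <= sin (pi / M%:R * k%:R) ^+ 2 :> R by lra.
set x : R := pi / M%:R.
have pi0 := pi_gt0 R.
have xM : x * M%:R = pi by rewrite /x; field; lra.
have x0 : 0 < x by rewrite divr_gt0.
(* on [x, pi - x] the sine is at least sin x, its value at both ends *)
have k1 : 1 <= k%:R :> R by rewrite ler1n.
have kM : k%:R <= M%:R - 1 :> R by rewrite lerBrDr natr1 ler_nat.
have xk : x * k%:R <= pi - x by rewrite -xM -[X in _ - X]mulr1 -mulrBr ler_pM2l.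
have xk1 : x <= x * k%:R by rewrite ler_peMr// ltW.
have sx : 0 <= sin x by rewrite sin_ge0_pi//; lra.
rewrite ler_sqr ?nnegrE//; last by rewrite sin_ge0_pi//; lra.
have mono (u v : R) : 0 <= u -> u <= v -> v <= pi / 2 -> sin u <= sin v.
  move=> u0 uv vp; have := @ltr_sin R v u.
  rewrite !in_itv /= => H; rewrite leNgt H -?leNgt//; lra.
have [h|h] := leP (x * k%:R) (pi / 2); first by apply: mono => //; lra.
have -> : sin (x * k%:R) = sin (pi - x * k%:R).
  by rewrite sinB sinpi cospi; ring.
apply: mono; lra.
Qed.

(** An antiperiodic sequence of antiperiod N is periodic of period 2N and has
    sum 0 over that period. *)
Lemma discrete_wirtinger_antiperiodic (R : realType) (N : nat) (u : nat -> R) :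
  (0 < N)%N -> (forall j, u (j + N)%N = - u j) ->
  4 * sin (pi / (2 * N%:R)) ^+ 2 * \sum_(j < N) u j ^+ 2
    <= \sum_(j < N) (u j.+1 - u j) ^+ 2.
Proof.
move=> N0 uN.
have uNN j : u (j + (N + N))%N = u j by rewrite addnA !uN opprK.
have u0 : \sum_(j < N + N) u j = 0.
  rewrite big_split_ord /= [X in _ + X](eq_bigr (fun i : 'I_N => - u i)).
    by rewrite sumrN subrr.
  by move=> i _; rewrite addnC uN.
have := discrete_wirtinger (ltn_addl N N0) uNN u0.
rewrite !big_split_ord /=.
rewrite [X in _ * (_ + X)](eq_bigr (fun i : 'I_N => u i ^+ 2)); last first.
  by move=> i _; rewrite addnC uN sqrrN.
rewrite [X in _ <= _ + X](eq_bigr (fun i : 'I_N => (u i.+1 - u i) ^+ 2)); last first.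
  by move=> i _; rewrite -addnS !(addnC N) !uN -opprD sqrrN.
by rewrite natrD -mulr2n -[_ *+ 2]mulr_natl; lra.
Qed.

(** Sturm comparison: the Casoratian s_m W_(m+1) - s_(m+1) W_m starts at 0 and, as
    long as s is nonnegative, does not decrease. *)
Lemma discrete_sturm (R : realDomainType) (W s : nat -> R) (c : R) (K : nat) :
  W 0 = 0 -> W 1 = 0 -> (forall m, c * W m.+1 <= W m.+2 + W m) ->
  s 0 = 0 -> (forall m, s m.+2 + s m = c * s m.+1) ->
  (forall m, (0 < m < K)%N -> 0 < s m) -> 0 <= s K ->
  forall m, (m <= K)%N -> 0 <= W m.
Proof.
move=> W0 W1 HW s0 Hs spos sK.
have sge m : (m <= K)%N -> 0 <= s m.
  rewrite leq_eqVlt => /predU1P[->//|mK].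
  by case: m mK => [|m] mK; [rewrite s0|rewrite ltW// spos].
have Z m : (m <= K)%N -> 0 <= s m * W m.+1 - s m.+1 * W m.
  elim: m => [|m IH] mK; first by rewrite W0 W1 !mulr0 subrr.
  apply: le_trans (IH (ltnW mK)) _.
  have := ler_wpM2l (sge _ mK) (HW m).
  have -> : s m.+2 = c * s m.+1 - s m by rewrite -Hs addrK.
  lra.
elim=> [|m IH] mK; first by rewrite W0.
case: m IH mK => [|m] IH mK; first by rewrite W1.
have sm : 0 < s m.+1 by rewrite spos.
rewrite -(pmulr_rge0 _ sm); have := Z _ (ltnW mK).
have := mulr_ge0 (sge _ mK) (IH (ltnW mK)); lra.
Qed.

(** Discrete version of an argument of Lükő.  Let F_m be the sum of the squared
    m-step increments.  The second difference of F at m is 2 F_1 minus the sum of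
    the squared one-step increments of the m-step increments, hence, by the
    Wirtinger inequality, at most 2 F_1 - 4 sin^2(pi/N) F_m.  The sequence
    G_m = sin^2(m pi/N)/sin^2(pi/N) F_1 satisfies this with equality, and agrees
    with F for m = 0 and m = 1.  Comparison with sin(2 pi m/N) therefore gives
    F_m <= G_m while 2 m <= N; the reflection of m into N - m does the rest. *)
Lemma discrete_chord (R : realType) (N m : nat) (y : nat -> R) :
  (1 < N)%N -> (forall j, y (j + N)%N = y j) -> (m <= N)%N ->
  sin (pi / N%:R) ^+ 2 * \sum_(j < N) (y (j + m)%N - y j) ^+ 2
    <= sin (pi / N%:R * m%:R) ^+ 2 * \sum_(j < N) (y j.+1 - y j) ^+ 2.
Proof.
move=> N1 yN; have N0 : (0 < N)%N by exact: ltnW.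
have NR : 0 < N%:R :> R by rewrite ltr0n.
set x : R := pi / N%:R; pose F k := \sum_(j < N) (y (j + k)%N - y j) ^+ 2.
have xN : x * N%:R = pi by rewrite /x; field; lra.
have -> : \sum_(j < N) (y j.+1 - y j) ^+ 2 = F 1.
  by apply: eq_bigr => j _; rewrite addn1.
rewrite -/(F m); wlog mN : m / (m.*2 <= N)%N.
  move=> H mN; have [|Nm] := leqP m.*2 N; first by move/H; exact.
  have -> : F m = F (N - m)%N.
    rewrite /F -(sum_periodic_shift m (y := fun j => (y (j + (N - m))%N - y j) ^+ 2)).
      by apply: eq_bigr => j _; rewrite -addnA subnKC// yN -sqrrN opprB.
    by move=> j; rewrite -addnA [(N + _)%N]addnC addnA !yN.
  have -> : sin (x * m%:R) = sin (x * (N - m)%:R).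
    by rewrite natrB// mulrBr xN sinB sinpi cospi; ring.
  apply: H; last by rewrite leq_subr.
  by rewrite doubleB leq_subLR -addnn leq_add2r ltnW.
move=> _; pose W k := sin (x * k%:R) ^+ 2 * F 1 - sin x ^+ 2 * F k.
suff : 0 <= W m by rewrite subr_ge0.
pose A k := \sum_(j < N) y j * y (j + k)%N.
have ASh k l : \sum_(j < N) y (j + l)%N * y (j + k + l)%N = A k.
  rewrite /A -(sum_periodic_shift l (y := fun j => y j * y (j + k)%N)).
    by apply: eq_bigr => j _; rewrite addnAC.
  by move=> j; rewrite yN addnAC yN.
have FE k : F k = 2 * A 0 - 2 * A k.
  have -> : 2 * A 0 = \sum_(j < N) y j * y (j + 0)%N
      + \sum_(j < N) y (j + k)%N * y (j + 0 + k)%N by rewrite ASh -/(A 0); ring.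
  rewrite /F /A mulr_sumr -big_split -sumrB; apply: eq_bigr => j _ /=.
  rewrite addn0; ring.
have F2 k : F k.+2 + F k - 2 * F k.+1 =
    2 * F 1 - \sum_(j < N) ((y (j.+1 + k.+1)%N - y j.+1) - (y (j + k.+1)%N - y j)) ^+ 2.
  have -> : \sum_(j < N) ((y (j.+1 + k.+1)%N - y j.+1) - (y (j + k.+1)%N - y j)) ^+ 2 =
     A 0 + A 0 + A 0 + A 0 + 2 * (A k.+2 + A k - A k.+1 - A k.+1 - A 1 - A 1).
    rewrite -{1}(ASh 0 k.+2) -{1}(ASh 0 1) -{1}(ASh 0 k.+1).
    rewrite -{1}(ASh k 1) -{1}(ASh k.+1 1) -{1}(ASh 1 k.+1).
    rewrite /A -!big_split -!sumrB mulr_sumr -big_split.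
    apply: eq_bigr => j _ /=.
    rewrite !addn0 !addn1 ?addSn ?addnS ?addn1 ?addn0; ring.
  rewrite !FE; ring.
apply: (discrete_sturm (s := fun k => sin (x *+ 2 * k%:R)) (c := 2 * cos (x *+ 2)) (K := m)) => //.
- rewrite /W /F mulr0 sin0 expr0n mul0r [X in _ * X]big1 ?mulr0 ?subrr// => j _.
  by rewrite addn0 subrr expr0n.
- by rewrite /W mulr1 subrr.
- move=> k.
  have wirt : 4 * sin x ^+ 2 * F k.+1 <=
      \sum_(j < N) ((y (j.+1 + k.+1)%N - y j.+1) - (y (j + k.+1)%N - y j)) ^+ 2.
    apply: (discrete_wirtinger (y := fun j => y (j + k.+1)%N - y j)) => //.
      by move=> j; rewrite addnAC !yN.
    by rewrite sumrB sum_periodic_shift// subrr.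
  have := ler_wpM2l (sqr_ge0 (sin x)) wirt.
  have F2k : F k.+2 = 2 * F 1 -
      \sum_(j < N) ((y (j.+1 + k.+1)%N - y j.+1) - (y (j + k.+1)%N - y j)) ^+ 2
      + 2 * F k.+1 - F k.
    by rewrite -F2; ring.
  rewrite /W F2k; set Q := \sum_(j < N) _.
  have -> : x * k.+2%:R = x * k.+1%:R + x by rewrite -[k.+2%:R]natr1; ring.
  have -> : x * k%:R = x * k.+1%:R - x by rewrite -[k.+1%:R]natr1; ring.
  rewrite sinD sinB cos_mulr2n.
  have h1 := cos2sin2 x; have h2 := cos2sin2 (x * k.+1%:R).
  set s := sin x in h1 *; set c := cos x in h1 *.
  set S := sin _ in h2 *; set C := cos _ in h2 *.
  move: (F 1) (F k.+1) (F k) Q => f1 fk1 fk q h.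
  rewrite -subr_ge0; rewrite -subr_ge0 in h; apply: le_trans h _.
  rewrite le_eqVlt; apply/orP; left; apply/eqP; ring: h1 h2.
- by rewrite mulr0 sin0.
- move=> k; have -> : x *+ 2 * k.+2%:R = x *+ 2 * k.+1%:R + x *+ 2.
    by rewrite -[k.+2%:R]natr1; ring.
  have -> : x *+ 2 * k%:R = x *+ 2 * k.+1%:R - x *+ 2.
    by rewrite -[k.+1%:R]natr1; ring.
  rewrite sinD sinB; ring.
- move=> k /andP[k0 km]; apply: sin_gt0_pi.
  have -> : x *+ 2 * k%:R = x * k.*2%:R by rewrite -mul2n natrM; ring.
  have x0 : 0 < x by rewrite divr_gt0 ?pi_gt0.
  rewrite mulr_gt0 ?ltr0n ?double_gt0//= -xN ltr_pM2l// ltr_nat.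
  by rewrite (leq_trans _ mN)// ltn_double.
- apply: sin_ge0_pi.
  have -> : x *+ 2 * m%:R = x * m.*2%:R by rewrite -mul2n natrM; ring.
  have x0 : 0 < x by rewrite divr_gt0 ?pi_gt0.
  by rewrite mulr_ge0 ?(ltW x0)//= -xN ler_pM2l// ler_nat.
Qed.

(** * From grids to integrals over a period *)

Lemma continuous_integrable_itv (R : realType) (f : R -> R) (a b : R) :
  continuous f -> lebesgue_measure.-integrable `[a, b] (EFin \o f).
Proof.
move=> cf; apply: continuous_compact_integrable; first exact: segment_compact.
by apply: continuous_subspaceT => x; exact: cf.
Qed.

Lemma sqr_continuous (R : realType) (f : R -> R) :
  continuous f -> continuous (fun x => f x ^+ 2).
Proof. by move=> cf x; apply: cvgM; exact: cf. Qed.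

Lemma Rintegral_chasles (R : realType) (f : R -> R) (a c b : R) :
  a <= c -> c <= b -> lebesgue_measure.-integrable `[a, b] (EFin \o f) ->
  \int[lebesgue_measure]_(x in `[a, b]) f x =
  \int[lebesgue_measure]_(x in `[a, c]) f x +
  \int[lebesgue_measure]_(x in `[c, b]) f x.
Proof.
move=> ac cb fi; apply/eqP; rewrite addrC -subr_eq; apply/eqP.
rewrite Rintegral_itvB ?bnd_simp// Rintegral_itv_obnd_cbnd//.
apply: integrableS fi => //; apply: subset_itvr.
by rewrite bnd_simp.
Qed.

(** Summing an antiderivative Q of q over the grid that starts at t gives a function
    of t whose derivative is at most C, and which increases by the whole integral
    of q when t runs through one step. *)
Lemma grid_average (R : realType) (q : R -> R) (T C : R) (N : nat) :
  continuous q -> 0 < T -> (0 < N)%N ->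
  (forall t : R, 0 <= t <= T / N%:R -> \sum_(j < N) q (t + j%:R * (T / N%:R)) <= C) ->
  \int[lebesgue_measure]_(x in `[0, T]) q x <= C * (T / N%:R).
Proof.
move=> cq T0 N0 HC; set e := T / N%:R.
have e0 : 0 < e by rewrite divr_gt0// ltr0n.
have eN : N%:R * e = T by rewrite /e mulrCA divff ?mulr1// pnatr_eq0 -lt0n.
pose Q (x : R) := \int[lebesgue_measure]_(t in `[-1, x]) q t.
have dQ (x : R) : -1 < x -> is_derive x 1 Q (q x).
  move=> x1; have [d1 d2] := @continuous_FTC1_closed R q (-1) x (x + 1)
    ltac:(by rewrite ltrDl) (continuous_integrable_itv _ _ cq) x1 (cq x).
  split; [exact: d1|by rewrite -derive1E d2].
have -> : \int[lebesgue_measure]_(x in `[0, T]) q x = Q T - Q 0.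
  rewrite /Q (@Rintegral_chasles _ _ (-1) 0 T) ?lerN10 ?ltW//.
    by rewrite addrC addKr.
  exact: continuous_integrable_itv.
pose S (t : R) := \sum_(j < N) Q (t + j%:R * e).
have -> : Q T - Q 0 = S e - S 0.
  have -> : Q T - Q 0 = \sum_(0 <= j < N) (Q (j.+1%:R * e) - Q (j%:R * e)).
    by rewrite (telescope_sumr (fun j : nat => Q (j%:R * e)))// mul0r eN.
  rewrite big_mkord /S -sumrB.
  by apply: eq_bigr => j _; rewrite -natr1; congr (Q _ - Q _); ring.
have dS (t : R) : -1 < t -> is_derive t 1 S (\sum_(j < N) q (t + j%:R * e)).
  move=> t1; have -> : S = \sum_(j < N) (Q \o (fun t => t + j%:R * e)).
    by apply/funext => u; rewrite /S fct_sumE.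
  apply: is_derive_sum => j.
  rewrite -[X in is_derive _ _ _ X]mulr1; apply: is_derive1_comp.
    by apply: dQ; rewrite (lt_le_trans t1)// lerDl mulr_ge0// ltW.
  rewrite -[1 in X in is_derive _ _ _ X]addr0.
  by apply: is_deriveD.
have [||c ce ->] := @MVT R S (fun t => \sum_(j < N) q (t + j%:R * e)) 0 e e0.
- by move=> t; rewrite in_itv /= => /andP[t0 _]; apply: dS; rewrite (lt_trans _ t0)// ltrN10.
- apply: derivable_within_continuous => t; rewrite in_itv /= => /andP[t0 _].
  by apply: (@ex_derive _ _ _ _ _ _ _ (dS t _)); rewrite (lt_le_trans _ t0)// ltrN10.
rewrite subr0; apply: ler_wpM2r; first exact: ltW.
apply: HC.
by move: ce; rewrite in_itv /= => /andP[c0 c1]; rewrite !ltW.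
Qed.

Lemma mul_cos_le_sin (R : realType) (x : R) : 0 <= x <= pi -> x * cos x <= sin x.
Proof.
move=> /andP[x0 xpi]; have [|c] := @MVT_segment R sin cos 0 x x0 (fun y _ => is_derive_sin y).
  by apply: continuous_subspaceT; exact: continuous_sin.
rewrite in_itv /= sin0 !subr0 => /andP[c0 cx] ->.
rewrite mulrC ler_wpM2r// leNgt; apply/negP => h.
have := @ltr_cos R x c; rewrite !in_itv /= x0 xpi c0 (le_trans cx xpi).
by move=> /(_ isT isT); rewrite h ltNge cx.
Qed.

(** The limit p -> oo, where sin x / x tends to 1 along x = c/p. *)
Lemma le_of_sinc_le (R : realType) (c I J : R) :
  0 < c -> c <= pi / 2 -> 0 <= I ->
  (forall p : nat, I * sin (c / p.+1%:R) ^+ 2 <= (c / p.+1%:R) ^+ 2 * J) ->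
  I <= J.
Proof.
move=> c0 cpi I0 H; pose x (p : nat) := c / p.+1%:R.
have Hx p : I * cos (x p) ^+ 2 <= J.
  have xp0 : 0 < x p by rewrite divr_gt0.
  have xpi : x p <= pi / 2.
    by rewrite (le_trans _ cpi)// ler_pdivrMr// ler_peMr ?ler1n// ltW.
  have pi0 := pi_gt0 R.
  rewrite -(ler_pM2l (exprn_gt0 2 xp0)); apply: le_trans (H p).
  rewrite mulrCA ler_wpM2l// -exprMn ler_sqr ?nnegrE.
  - apply: mul_cos_le_sin; rewrite (ltW xp0) /= (le_trans xpi)//; lra.
  - apply: mulr_ge0; first exact: ltW.
    apply: cos_ge0_pihalf; rewrite xpi andbT (le_trans _ (ltW xp0))//.
    by rewrite oppr_le0; lra.
  - apply: sin_ge0_pi; rewrite (ltW xp0) /= (le_trans xpi)//; lra.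
have cx : x @ \oo --> 0.
  rewrite -(mulr0 c); apply: cvgMr; exact: cvg_harmonic.
have : (fun p => I * cos (x p) ^+ 2) @ \oo --> I * cos 0 ^+ 2.
  apply: cvgMr; rewrite expr2.
  have cc : (fun p => cos (x p)) @ \oo --> cos (0 : R).
    by apply: (continuous_cvg _ (@continuous_cos R 0)).
  exact: cvgM.
rewrite cos0 expr1n mulr1 => /cvgr_to_le; apply; near=> p; exact: Hx.
Unshelve. all: by end_near. Qed.

(** Merges two adjacent increments; the cross term 2 p q is bounded by the
    arithmetic-geometric mean inequality. *)
Lemma sqr_add_le (R : realFieldType) (p q l1 l2 A B : R) :
  0 <= l1 -> 0 <= l2 -> 0 <= A -> 0 <= B ->
  p ^+ 2 <= l1 * A -> q ^+ 2 <= l2 * B -> (p + q) ^+ 2 <= (l1 + l2) * (A + B).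
Proof.
move=> l10 l20 A0 B0 pA qB.
have m0 : 0 <= l1 * B + l2 * A by rewrite addr_ge0// mulr_ge0.
suff : 2 * (p * q) <= l1 * B + l2 * A by move: pA qB; lra.
apply: le_trans (ler_norm _) _.
rewrite -ler_sqr ?nnegrE// real_normK ?num_real//.
have -> : (2 * (p * q)) ^+ 2 = 4 * (p ^+ 2 * q ^+ 2) by ring.
have : p ^+ 2 * q ^+ 2 <= (l1 * A) * (l2 * B) by rewrite ler_pM ?sqr_ge0.
have := sqr_ge0 (l1 * B - l2 * A); lra.
Qed.

(** The function H stands for the energy of f on [0, x].  As f is only controlled on
    [0, T], the chord that leaves this interval is cut at T, and its second half is
    brought back to the origin by the periodicity (s = 1) or the antiperiodicity
    (s = -1). *)
Lemma grid_increments (R : realType) (f H : R -> R) (s T : R) (N : nat) (t : R) :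
  0 < T -> (0 < N)%N -> s ^+ 2 = 1 -> (forall x, f (x + T) = s * f x) ->
  (forall a b : R, 0 <= a -> a <= b -> b <= T -> H a <= H b) ->
  (forall a b : R, 0 <= a -> a <= b -> b <= T ->
     (f b - f a) ^+ 2 <= (b - a) * (H b - H a)) ->
  0 <= t <= T / N%:R ->
  \sum_(j < N) (f (t + j.+1%:R * (T / N%:R)) - f (t + j%:R * (T / N%:R))) ^+ 2
    <= T / N%:R * (H T - H 0).
Proof.
move=> T0; case: N => // N _ s1 fT Hmono Hf /andP[t0 te].
set e := T / _ in te *.
have eN : N.+1%:R * e = T by rewrite /e mulrCA divff ?mulr1.
have e0 : 0 < e by rewrite divr_gt0.
have NT : t + N%:R * e <= T by rewrite -eN -natr1 mulrDl mul1r addrC lerD2l.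
have tT : t <= T by rewrite (le_trans _ NT)// lerDl mulr_ge0// ltW.
rewrite big_ord_recr /= eN fT.
have inner : \sum_(j < N) (f (t + j.+1%:R * e) - f (t + j%:R * e)) ^+ 2
    <= e * (H (t + N%:R * e) - H t).
  have -> : H (t + N%:R * e) - H t =
      \sum_(0 <= j < N) (H (t + j.+1%:R * e) - H (t + j%:R * e)).
    by rewrite (telescope_sumr (fun j : nat => H (t + j%:R * e)))// mul0r addr0.
  rewrite big_mkord mulr_sumr.
  apply: ler_sum => j _.
  have -> : e * (H (t + j.+1%:R * e) - H (t + j%:R * e)) =
    ((t + j.+1%:R * e) - (t + j%:R * e)) * (H (t + j.+1%:R * e) - H (t + j%:R * e)).
    by congr (_ * _); rewrite -natr1; ring.
  have jj : j%:R * e <= j.+1%:R * e by rewrite ler_wpM2r ?ler_nat// ltW.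
  apply: Hf; rewrite ?lerD2l//.
    by rewrite addr_ge0// mulr_ge0// ltW.
  by rewrite (le_trans _ NT)// lerD2l ler_wpM2r ?ler_nat// ltW.
have N0 : 0 <= t + N%:R * e by rewrite addr_ge0// mulr_ge0// ltW.
have last : (s * f t - f (t + N%:R * e)) ^+ 2
    <= (t + (T - (t + N%:R * e))) * ((H t - H 0) + (H T - H (t + N%:R * e))).
  have -> : s * f t - f (t + N%:R * e) =
      s * (f t - f 0) + (f T - f (t + N%:R * e)).
    have -> : f T = s * f 0 by rewrite -{1}(add0r T) fT.
    ring.
  apply: sqr_add_le => //.
  - by rewrite subr_ge0.
  - by rewrite subr_ge0 Hmono.
  - by rewrite subr_ge0 Hmono.
  - by rewrite exprMn s1 mul1r -{2}(subr0 t) Hf.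
  - by rewrite Hf.
have eE : t + (T - (t + N%:R * e)) = e by rewrite -eN -natr1; ring.
rewrite eE in last; lra.
Qed.

(** The discrete inequality on the grids of step 2 pi/N, averaged over their starting
    points; the constant tends to 4 as N grows. *)
Lemma wirtinger_of_increments (R : realType) (f H : R -> R) :
  continuous f -> (forall x, f (x + 2 * pi) = - f x) ->
  (forall a b : R, 0 <= a -> a <= b -> b <= 2 * pi -> H a <= H b) ->
  (forall a b : R, 0 <= a -> a <= b -> b <= 2 * pi ->
     (f b - f a) ^+ 2 <= (b - a) * (H b - H a)) ->
  \int[lebesgue_measure]_(x in `[0, 2 * pi]) (f x ^+ 2)
    <= 4 * (H (2 * pi) - H 0).
Proof.
move=> cf fpi Hmono Hf; have pi0 := pi_gt0 R.
apply: (@le_of_sinc_le R (pi / 2)) => //; first lra.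
  by apply: Rintegral_ge0 => x _; exact: sqr_ge0.
move=> p; set N := p.+1; set x := pi / 2 / N%:R.
have NR : 0 < N%:R :> R by rewrite ltr0n.
have x0 : 0 < x by rewrite !divr_gt0.
have eE : 2 * pi / N%:R = 4 * x by rewrite /x; field; rewrite gt_eqF.
have sx : 0 < sin x.
  rewrite sin_gt0_pi// x0 /= /x ltr_pdivrMr//.
  rewrite (@lt_le_trans _ _ pi)//; first lra.
  by rewrite ler_peMr ?ler1n// ltW.
have grid (t : R) : 0 <= t <= 4 * x ->
    \sum_(j < N) f (t + j%:R * (4 * x)) ^+ 2
      <= x / sin x ^+ 2 * (H (2 * pi) - H 0).
  move=> tE.
  have := @grid_increments R f H (-1) (2 * pi) N t _ isT _ _ Hmono Hf.
  rewrite eE sqrrN expr1n => G.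
  have {}G := G ltac:(by rewrite mulr_gt0) erefl ltac:(by move=> y; rewrite fpi mulN1r) tE.
  have anti (j : nat) : f (t + (j + N)%:R * (4 * x)) = - f (t + j%:R * (4 * x)).
    by rewrite natrD mulrDl addrA -eE [N%:R * _]mulrC divfK ?fpi// gt_eqF.
  have := le_trans (@discrete_wirtinger_antiperiodic R N _ isT anti) G.
  have -> : pi / (2 * N%:R) = x by rewrite /x; field; rewrite gt_eqF.
  move=> W; rewrite -(ler_pM2l (exprn_gt0 2 sx)).
  have -> : sin x ^+ 2 * (x / sin x ^+ 2 * (H (2 * pi) - H 0)) =
    x * (H (2 * pi) - H 0) by field; rewrite gt_eqF.
  by move: W; lra.
have := @grid_average R (fun x => f x ^+ 2) (2 * pi) _ N (sqr_continuous cf) _ isT.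
rewrite eE => /(_ _ ltac:(by rewrite mulr_gt0) grid).
rewrite -(ler_pM2l (exprn_gt0 2 sx)) mulrC => /le_trans; apply.
rewrite le_eqVlt; apply/orP; left; apply/eqP.
by field; rewrite gt_eqF.
Qed.

(** The number of grid points runs through the multiples of n, so that h tau is a
    whole number of steps. *)
Lemma chord_of_increments (R : realType) (n h : nat) (f H : R -> R) :
  continuous f -> (forall x, f (x + 2 * pi) = f x) -> (1 < n)%N -> (h <= n)%N ->
  (forall a b : R, 0 <= a -> a <= b -> b <= 2 * pi -> H a <= H b) ->
  (forall a b : R, 0 <= a -> a <= b -> b <= 2 * pi ->
     (f b - f a) ^+ 2 <= (b - a) * (H b - H a)) ->
  \int[lebesgue_measure]_(x in `[0, 2 * pi]) ((f (x + h%:R * tau n) - f x) ^+ 2)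
    <= 4 * sin (pi / n%:R * h%:R) ^+ 2 * (H (2 * pi) - H 0).
Proof.
move=> cf fpi n1 hn Hmono Hf; have pi0 := pi_gt0 R.
have nR : 0 < n%:R :> R by rewrite ltr0n ltnW.
have n2 : 2 <= n%:R :> R by rewrite ler_nat.
apply: (@le_of_sinc_le R (pi / n%:R)) => //.
- by rewrite divr_gt0.
- by rewrite ler_pdivrMr// mulrAC ler_pdivlMr// ler_wpM2l// ltW.
- by apply: Rintegral_ge0 => x _; exact: sqr_ge0.
move=> p; set N := (n * p.+1)%N.
have N1 : (1 < N)%N by rewrite (leq_trans n1)// leq_pmulr.
have NR : 0 < N%:R :> R by rewrite ltr0n ltnW.
have NE : N%:R = n%:R * p.+1%:R :> R by rewrite natrM.
have pR : 0 < p.+1%:R :> R by rewrite ltr0n.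
have xE : pi / n%:R / p.+1%:R = pi / N%:R :> R.
  by rewrite NE; field; rewrite !gt_eqF.
rewrite xE; set x : R := pi / N%:R.
have x0 : 0 < x by rewrite !divr_gt0.
have eE : 2 * pi / N%:R = 2 * x by rewrite /x; field; rewrite gt_eqF.
have tauE : h%:R * tau n = (h * p.+1)%:R * (2 * x).
  by rewrite /tau /x NE natrM; field; rewrite !gt_eqF.
have argE : x * (h * p.+1)%:R = pi / n%:R * h%:R.
  by rewrite /x NE natrM; field; rewrite !gt_eqF.
have sx : 0 < sin x.
  rewrite sin_gt0_pi// x0 /= /x ltr_pdivrMr// ltr_pMr//.
  by rewrite ltr1n.
set S := sin (pi / n%:R * h%:R).
have cd : continuous (fun x => (f (x + h%:R * tau n) - f x) ^+ 2).
  apply: sqr_continuous => y; apply: cvgB; last exact: cf.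
  apply: (@continuous_comp _ _ _ (fun y => y + h%:R * tau n) f); last exact: cf.
  by apply: cvgD; [exact: cvg_id|exact: cvg_cst].
have grid (t : R) : 0 <= t <= 2 * x ->
    \sum_(j < N) (f (t + j%:R * (2 * x) + h%:R * tau n) - f (t + j%:R * (2 * x))) ^+ 2
      <= S ^+ 2 * (2 * x) / sin x ^+ 2 * (H (2 * pi) - H 0).
  move=> tE.
  have := @grid_increments R f H 1 (2 * pi) N t _ (ltnW N1) _ _ Hmono Hf.
  rewrite eE expr1n => G.
  have {}G := G ltac:(by rewrite mulr_gt0) erefl ltac:(by move=> y; rewrite fpi mul1r) tE.
  have per (j : nat) : f (t + (j + N)%:R * (2 * x)) = f (t + j%:R * (2 * x)).
    by rewrite natrD mulrDl addrA -eE [N%:R * _]mulrC divfK ?fpi// gt_eqF.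
  have hN : (h * p.+1 <= N)%N by rewrite leq_mul2r hn orbT.
  have := discrete_chord N1 per hN.
  rewrite -/x argE -/S => W.
  have {}W := le_trans W (ler_wpM2l (sqr_ge0 S) G).
  rewrite -(ler_pM2l (exprn_gt0 2 sx)).
  have -> : sin x ^+ 2 * (S ^+ 2 * (2 * x) / sin x ^+ 2 * (H (2 * pi) - H 0)) =
     S ^+ 2 * (2 * x * (H (2 * pi) - H 0)) by field; rewrite gt_eqF.
  apply: le_trans W; rewrite ler_wpM2l ?sqr_ge0// ler_sum// => j _.
  by rewrite tauE (natrD _ j) (mulrDl j%:R) addrA.
have := @grid_average R _ (2 * pi) _ N cd _ (ltnW N1).
rewrite eE => /(_ _ ltac:(by rewrite mulr_gt0) grid).
rewrite -(ler_pM2l (exprn_gt0 2 sx)) mulrC => /le_trans; apply.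
rewrite le_eqVlt; apply/orP; left; apply/eqP.
by field; rewrite gt_eqF.
Qed.

(** * A piecewise quadratic ramp *)

Definition pospart {R : realType} (x : R) : R := Num.max 0 x.

(** The difference quotient differs from the derivative by at most |h|. *)
Lemma is_derive_sqr_pospart (R : realType) (x : R) :
  is_derive x 1 (fun y => pospart y ^+ 2) (2 * pospart x).
Proof.
have H : h^-1 *: (pospart (h *: 1 + x) ^+ 2 - pospart x ^+ 2) @[h --> 0^'] --> 2 * pospart x.
  apply/cvgrPdist_le => e e0; near=> h.
  have h0 : h != 0 by near: h; exact: nbhs_dnbhs_neq.
  have he : `|h| <= e.
    near: h; apply: dnbhs0_le => //.
  apply: le_trans he; rewrite /GRing.scale /= mulr1.
  rewrite -(ler_pM2r (x := `|h|)) ?normr_gt0// -normrM mulrBl.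
  rewrite [h^-1 * _ * h]mulrAC mulVf// mul1r -normrM -expr2 [leRHS]ger0_norm ?sqr_ge0//.
  rewrite ler_norml /pospart.
  have := sqr_ge0 h; have := sqr_ge0 (h + x) => ? ?.
  by case: (leP 0 x) => ?; case: (leP 0 (h + x)) => ?; apply/andP; split; nra.
by apply: DeriveDef; [apply: cvgP H|apply: cvg_lim H].
Unshelve. all: by end_near. Qed.

(** A C^1 quadratic spline that climbs from 0 at x = 0 to 1 at x = 1. *)
Definition ramp {R : realType} (x : R) : R :=
  2 * pospart x ^+ 2 - 4 * pospart (x - 2^-1) ^+ 2 + 2 * pospart (x - 1) ^+ 2.

Definition dramp {R : realType} (x : R) : R :=
  4 * pospart x - 8 * pospart (x - 2^-1) + 4 * pospart (x - 1).

Lemma is_derive_ramp (R : realType) (x : R) : is_derive x 1 ramp (dramp x).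
Proof.
have D c (y : R) : is_derive y 1 (fun z => pospart (z - c) ^+ 2) (2 * pospart (y - c)).
  rewrite -[X in is_derive _ _ _ X]mulr1.
  apply: (@is_derive1_comp _ (fun y => pospart y ^+ 2) (fun z => z - c)).
    exact: is_derive_sqr_pospart.
  by rewrite -[1 in X in is_derive _ _ _ X]subr0; apply: is_deriveB.
have -> : (ramp : R -> R) = 2 *: (fun z => pospart z ^+ 2)
   - 4 *: (fun z => pospart (z - 2^-1) ^+ 2) + 2 *: (fun z => pospart (z - 1) ^+ 2).
  by apply/funext.
have D0 := is_derive_sqr_pospart x; have D1 := D 2^-1 x; have D2 := D 1 x.
have -> : dramp x = 2 *: (2 * pospart x) - 4 *: (2 * pospart (x - 2^-1))
   + 2 *: (2 * pospart (x - 1)) by rewrite /dramp /GRing.scale /=; ring.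
exact: is_deriveD.
Qed.

Lemma continuous_dramp (R : realType) : continuous (@dramp R).
Proof.
have C (c : R) : continuous (fun x : R => pospart (x - c)).
  move=> x; apply: (@continuous_max _ _ (cst 0) (fun x => x - c)).
    exact: cvg_cst.
  by apply: cvgB; [exact: cvg_id|exact: cvg_cst].
move=> x; apply: cvgD; first apply: cvgB.
- apply: cvgM; first exact: cvg_cst.
  have := C 0 x; rewrite /continuous_at subr0.
  rewrite (_ : (fun x => pospart (x - 0)) = pospart)//.
  by apply/funext => y; rewrite subr0.
- by apply: cvgM; [exact: cvg_cst|exact: C].
- by apply: cvgM; [exact: cvg_cst|exact: C].
Qed.

Ltac ramp_cases x := rewrite /ramp /dramp /pospart;
  case: (leP 0 x) => ?; case: (leP 0 (x - 2^-1)) => ?; case: (leP 0 (x - 1)) => ?.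

Lemma ramp_le0 (R : realType) (x : R) : x <= 0 -> ramp x = 0.
Proof. by move=> x0; ramp_cases x; nra. Qed.

Lemma ramp_ge1 (R : realType) (x : R) : 1 <= x -> ramp x = 1.
Proof. by move=> x1; ramp_cases x; nra. Qed.

Lemma ramp_ge0 (R : realType) (x : R) : 0 <= ramp x.
Proof. by ramp_cases x; nra. Qed.

Lemma ramp_le1 (R : realType) (x : R) : ramp x <= 1.
Proof. by ramp_cases x; nra. Qed.

Lemma dramp_ge0 (R : realType) (x : R) : 0 <= dramp x.
Proof. by ramp_cases x; nra. Qed.

Lemma dramp_eq0 (R : realType) (x : R) : x <= 0 \/ 1 <= x -> dramp x = 0.
Proof. by move=> [] ?; ramp_cases x; nra. Qed.

(** * Test functions and integrals over segments *)

Lemma locally_integrable_itv (R : realType) (g : R -> R) (a b : R) :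
  locally_integrable setT g -> lebesgue_measure.-integrable `[a, b] (EFin \o g).
Proof.
move=> [mg _ gK]; apply/integrableP; split.
  by apply/measurable_EFinP; apply: measurable_funTS.
by apply: gK => //; exact: segment_compact.
Qed.

Lemma continuous_bounded_itv (R : realType) (h : R -> R) (a b : R) :
  continuous h -> [bounded h x | x in `[a, b]].
Proof.
move=> ch.
have /compact_bounded[M [Mr HM]] := @continuous_compact _ _ h `[a, b]
  (continuous_subspaceT ch) (@segment_compact R a b).
by exists M; split=> // e Me x xab; apply: HM => //; exists x.
Qed.

Lemma integrable_mul_continuous (R : realType) (h g : R -> R) (a b : R) :
  continuous h -> lebesgue_measure.-integrable `[a, b] (EFin \o g) ->
  lebesgue_measure.-integrable `[a, b] (EFin \o (fun x => h x * g x)).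
Proof.
move=> ch gi.
apply: (@integrableMr _ _ _ (@lebesgue_measure R) _ _ h (EFin \o g)) => //.
  by apply: measurable_funTS; exact: continuous_measurable_fun.
exact: continuous_bounded_itv.
Qed.

Lemma is_derive_continuous (R : realType) (F f : R -> R) :
  (forall x : R, is_derive x 1 F (f x)) -> continuous F.
Proof.
move=> dF x; apply: differentiable_continuous; apply/derivable1_diffP.
by have [] := dF x.
Qed.

Lemma FTC2_everywhere (R : realType) (F f : R -> R) (a b : R) :
  a <= b -> (forall x : R, is_derive x 1 F (f x)) -> continuous f ->
  \int[lebesgue_measure]_(x in `[a, b]) f x = F b - F a.
Proof.
move=> + dF cf; rewrite le_eqVlt => /predU1P[->|ab].
  by rewrite set_itv1 Rintegral_set1 subrr.
have cF := is_derive_continuous dF.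
rewrite /Rintegral (@continuous_FTC2 R f F a b)//.
- exact: continuous_subspaceT.
- split; first by move=> x _; have [] := dF x.
  + by apply: cvg_at_right_filter; exact: cF.
  + by apply: cvg_at_left_filter; exact: cF.
- by move=> x _; rewrite derive1E; have [] := dF x.
Qed.

Lemma Rintegral_support (R : realType) (h : R -> R) (a b : R) :
  (forall x : R, x <= a \/ b <= x -> h x = 0) ->
  \int[lebesgue_measure]_x h x = \int[lebesgue_measure]_(x in `[a, b]) h x.
Proof.
move=> h0; rewrite [RHS]Rintegral_mkcond; congr (Rintegral _ _ _).
apply/funext => x; rewrite patchE; case: ifPn => // /negP xab.
apply: h0; have [|ax] := leP x a; first by left.
right; rewrite leNgt; apply/negP => xb; apply: xab.
by rewrite inE /= in_itv /= !ltW.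
Qed.

Lemma C1c_of_itv (R : realType) (phi dphi : R -> R) (a b : R) :
  (forall x : R, is_derive x 1 phi (dphi x)) -> continuous dphi ->
  (forall x : R, x <= a \/ b <= x -> phi x = 0) -> C1c phi.
Proof.
move=> dphiE cd phi0; have E : derive1 phi = dphi.
  by apply/funext => x; rewrite derive1E; have [] := dphiE x.
split; first by move=> x; have [] := dphiE x.
  by rewrite E.
apply: (@subclosed_compact _ _ `[a, b]) => //.
- exact: closed_closure.
- exact: segment_compact.
- have cl : closed `[a, b]%classic by exact: interval_closed.
  rewrite (closure_id `[a, b]%classic).1//; apply: closure_subset => x /=.
  move=> /eqP px; rewrite in_itv /=; apply/andP; split.
    by rewrite leNgt; apply/negP => h; apply: px; apply: phi0; left; exact: ltW.
  by rewrite leNgt; apply/negP => h; apply: px; apply: phi0; right; exact: ltW.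
Qed.

(** Far from the support phi vanishes on a neighbourhood, hence so does its
    derivative. *)
Lemma C1c_support (R : realType) (phi : R -> R) : C1c phi ->
  exists2 A, 0 < A & forall x : R, x <= - A \/ A <= x -> phi x = 0 /\ derive1 phi x = 0.
Proof.
move=> [dphi cphi cpt]; have [M [Mr HM]] := compact_bounded cpt.
pose A := `|M| + 2.
have out x : M < `|x| - 1 -> phi x = 0.
  move=> Mx; apply/eqP; apply: contraPT (HM _ Mx) => px; apply/existsNP.
  exists x; apply/not_implyP; split; first exact: subset_closure.
  by apply/negP; rewrite -ltNge; lra.
exists A; first by rewrite /A ltr_pwDr.
move=> x xA.
have xA' : A <= `|x|.
  case: xA => h; last exact: le_trans (ler_norm _).
  by rewrite -normrN; apply: le_trans (ler_norm _); rewrite lerNr.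
have MA : M <= `|M| by exact: ler_norm.
split; first by apply: out; rewrite /A in xA'; lra.
rewrite derive1E -(derive_cst (0 : R) x (1:R)); apply: near_eq_derive.
near=> y; apply: out.
have : `|x - y| < 1/2 by near: y; apply: nbhsx_ballx => //; lra.
have := ler_normD (x - y) y; rewrite subrK /A in xA' *; lra.
Unshelve. all: by end_near. Qed.

(** * The fundamental theorem of calculus for weak derivatives *)

(** The derivative of [x |-> ramp ((x - c) / d)]: a bump of mass 1 carried by
    [c, c + d]. *)
Definition window {R : realType} (c d x : R) : R := dramp ((x - c) / d) / d.

Lemma is_derive_ramp_affine (R : realType) (c d x : R) :
  is_derive x 1 (fun y => ramp ((y - c) / d)) (window c d x).
Proof.
apply: (@is_derive1_comp _ ramp (fun y => (y - c) / d)).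
  exact: is_derive_ramp.
rewrite (_ : (fun y => (y - c) / d) = d^-1 *: (fun y => y - c)); last first.
  by apply/funext => y; rewrite mulrC.
rewrite -[X in is_derive _ _ _ X]mulr1.
apply: is_deriveZ; rewrite -[1 in X in is_derive _ _ _ X]subr0.
exact: is_deriveB.
Qed.

Lemma ramp_affine_eq0 (R : realType) (c d x : R) :
  0 < d -> x <= c -> ramp ((x - c) / d) = 0.
Proof.
by move=> d0 xc; rewrite ramp_le0// pmulr_lle0 ?invr_gt0// subr_le0.
Qed.

Lemma ramp_affine_eq1 (R : realType) (c d x : R) :
  0 < d -> c + d <= x -> ramp ((x - c) / d) = 1.
Proof.
by move=> d0 xc; rewrite ramp_ge1// ler_pdivlMr// mul1r lerBrDl.
Qed.

Lemma window_eq0 (R : realType) (c d x : R) :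
  0 < d -> x <= c \/ c + d <= x -> window c d x = 0.
Proof.
move=> d0 xc; rewrite /window dramp_eq0 ?mul0r//; case: xc => xc; [left|right].
  by rewrite pmulr_lle0 ?invr_gt0// subr_le0.
by rewrite ler_pdivlMr// mul1r lerBrDl.
Qed.

Lemma window_ge0 (R : realType) (c d x : R) : 0 < d -> 0 <= window c d x.
Proof. by move=> d0; rewrite divr_ge0 ?dramp_ge0 ?(ltW d0). Qed.

Lemma continuous_window (R : realType) (c d : R) : continuous (window c d).
Proof.
move=> x; apply: cvgM; last exact: cvg_cst.
apply: (@continuous_comp _ _ _ (fun y => (y - c) / d) dramp).
  by apply: cvgM; [apply: cvgB; [exact: cvg_id|exact: cvg_cst]|exact: cvg_cst].
exact: continuous_dramp.
Qed.

Lemma window_average (R : realType) (f : R -> R) (A B c d l e : R) :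
  continuous f -> 0 < d -> A <= c -> c + d <= B ->
  (forall x, c <= x <= c + d -> `|f x - l| <= e) ->
  `| \int[lebesgue_measure]_(x in `[A, B]) (f x * window c d x) - l | <= e.
Proof.
move=> cf d0 Ac cB fl; have AB : A <= B by rewrite (le_trans Ac)// (le_trans _ cB)// lerDl ltW.
have cw := @continuous_window R c d.
have w1 : \int[lebesgue_measure]_(x in `[A, B]) window c d x = 1.
  rewrite (FTC2_everywhere AB (is_derive_ramp_affine c d))//.
  by rewrite ramp_affine_eq1// ramp_affine_eq0// subr0.
have cfl : continuous (fun x => f x - l).
  by move=> x; apply: cvgB; [exact: cf|exact: cvg_cst].
have cM (g : R -> R) : continuous g -> continuous (fun x => g x * window c d x).
  by move=> cg x; apply: cvgM; [exact: cg|exact: cw].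
have -> : \int[lebesgue_measure]_(x in `[A, B]) (f x * window c d x) - l =
    \int[lebesgue_measure]_(x in `[A, B]) ((f x - l) * window c d x).
  rewrite -[X in _ - X]mulr1 -w1 -RintegralZl//; last exact: continuous_integrable_itv.
  rewrite -RintegralB//.
  - by apply: eq_Rintegral => x _; rewrite mulrBl.
  - by apply: continuous_integrable_itv; exact: cM.
  - by apply: continuous_integrable_itv; apply: (cM (cst l)); exact: cst_continuous.
have I1 : lebesgue_measure.-integrable `[A, B] (EFin \o (fun x => (f x - l) * window c d x)).
  by apply: continuous_integrable_itv; exact: cM.
apply: le_trans (le_normr_Rintegral _ I1) _ => //.
rewrite -[leRHS]mulr1 -w1 -RintegralZl//; last exact: continuous_integrable_itv.
apply: le_Rintegral => //.
- by apply: continuous_integrable_itv => x; apply: cvg_norm; exact: (cM _ cfl x).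
- by apply: continuous_integrable_itv; apply: (cM (cst e)); exact: cst_continuous.
move=> x _; rewrite normrM (ger0_norm (window_ge0 _ _ d0)).
have [h|h] := boolP (c <= x <= c + d).
  by rewrite ler_wpM2r ?window_ge0 ?fl.
rewrite window_eq0 ?mulr0//.
by move: h; rewrite negb_and -!ltNge => /orP[] /ltW; [left|right].
Qed.

(** Both transition layers lie inside [a, b], so that testing against a cutoff only
    involves the values on [a, b]. *)
Definition cutoff {R : realType} (a b d x : R) : R :=
  ramp ((x - a) / d) - ramp ((x - (b - d)) / d).

Lemma is_derive_cutoff (R : realType) (a b d x : R) :
  is_derive x 1 (cutoff a b d) (window a d x - window (b - d) d x).
Proof. by apply: is_deriveB; exact: is_derive_ramp_affine. Qed.

Lemma continuous_dcutoff (R : realType) (a b d : R) :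
  continuous (fun x => window a d x - window (b - d) d x).
Proof. by move=> x; apply: cvgB; exact: continuous_window. Qed.

Lemma cutoff_eq0 (R : realType) (a b d x : R) :
  0 < d -> 2 * d <= b - a -> x <= a \/ b <= x -> cutoff a b d x = 0.
Proof.
move=> d0 dab [xa|bx]; rewrite /cutoff.
  by rewrite !ramp_affine_eq0 ?subrr//; lra.
by rewrite !ramp_affine_eq1 ?subrr//; lra.
Qed.

Lemma cutoff_eq1 (R : realType) (a b d x : R) :
  0 < d -> a + d <= x -> x <= b - d -> cutoff a b d x = 1.
Proof.
move=> d0 ax xb.
by rewrite /cutoff ramp_affine_eq1// ramp_affine_eq0// subr0.
Qed.

Lemma norm_cutoff_le1 (R : realType) (a b d x : R) : `|cutoff a b d x| <= 1.
Proof.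
have := ramp_ge0 ((x - a) / d); have := ramp_le1 ((x - a) / d).
have := ramp_ge0 ((x - (b - d)) / d); have := ramp_le1 ((x - (b - d)) / d).
by rewrite /cutoff ler_norml => *; apply/andP; split; lra.
Qed.

Lemma C1c_cutoff (R : realType) (a b d : R) :
  0 < d -> 2 * d <= b - a -> C1c (cutoff a b d).
Proof.
move=> d0 dab; apply: (C1c_of_itv (is_derive_cutoff a b d)) => //.
  exact: continuous_dcutoff.
by move=> x; exact: cutoff_eq0.
Qed.

Lemma derive1_cutoff (R : realType) (a b d : R) :
  derive1 (cutoff a b d) = (fun x => window a d x - window (b - d) d x).
Proof.
by apply/funext => x; rewrite derive1E; have [] := is_derive_cutoff a b d x.
Qed.

(** Test against cutoffs that increase to the indicator of ]a, b[.  Their derivatives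
    are the difference of two bumps of mass 1 that concentrate at a and b, which
    gives f a - f b on one side; on the other side the dominated convergence theorem
    gives minus the integral of g. *)
Lemma weak_FTC (R : realType) (f g : R -> R) (a b : R) :
  continuous f -> locally_integrable setT g -> is_weak_derivative_real f g ->
  a <= b -> f b - f a = \int[lebesgue_measure]_(x in `[a, b]) g x.
Proof.
move=> cf lg wfg; rewrite le_eqVlt => /predU1P[->|ab].
  by rewrite set_itv1 Rintegral_set1 subrr.
pose d (k : nat) : R := (b - a) / 2 / k.+1%:R.
have ba0 : 0 < (b - a) / 2 by lra.
have d0 k : 0 < d k by rewrite divr_gt0.
have dle k : 2 * d k <= b - a.
  have : d k <= (b - a) / 2 by rewrite ler_pdivrMr// ler_peMr ?ler1n// ltW.
  lra.
have dlim : d @ \oo --> 0.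
  by rewrite -(mulr0 ((b - a) / 2)); apply: cvgMr; exact: cvg_harmonic.
pose phi k := cutoff a b (d k).
have cphi k : continuous (phi k).
  exact: is_derive_continuous (is_derive_cutoff a b (d k)).
have idk k : \int[lebesgue_measure]_(x in `[a, b]) (f x * window a (d k) x) -
    \int[lebesgue_measure]_(x in `[a, b]) (f x * window (b - d k) (d k) x) =
    - \int[lebesgue_measure]_(x in `]a, b[) (phi k x * g x).
  have := wfg _ (C1c_cutoff (d0 k) (dle k)).
  rewrite derive1_cutoff (@Rintegral_support _ _ a b); last first.
    move=> x xab; have := dle k; have := d0 k => ? ?.
    by rewrite !window_eq0 ?subrr ?mulr0//; case: xab => ?; [left|right|left|right]; lra.
  rewrite (@Rintegral_support _ (fun x => g x * _) a b); last first.
    by move=> x xab; rewrite cutoff_eq0 ?mulr0.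
  have cI c : lebesgue_measure.-integrable `[a, b] (EFin \o (fun x => f x * window c (d k) x)).
    by apply: continuous_integrable_itv => x; apply: cvgM; [exact: cf|exact: continuous_window].
  under eq_Rintegral do rewrite mulrBr.
  rewrite RintegralB//= => ->; congr (- _).
  have gI : lebesgue_measure.-integrable `[a, b] (EFin \o (fun x => phi k x * g x)).
    by apply: integrable_mul_continuous => //; exact: locally_integrable_itv.
  rewrite Rintegral_itv_obnd_cbnd; last first.
    by apply: integrableS gI => //; apply: subset_itv; rewrite bnd_simp.
  rewrite Rintegral_itv_bndo_bndc; last first.
    by apply: integrableS gI => //; apply: subset_itvl; rewrite bnd_simp.
  by apply: eq_Rintegral => x _; rewrite mulrC.
have limA : (fun k => \int[lebesgue_measure]_(x in `[a, b]) (f x * window a (d k) x)) @ \oo --> f a.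
  apply/cvgrPdist_le => e e0.
  have := cf a => /cvgrPdist_le /(_ e e0) /nbhs_ballP[r /= r0 rf].
  near=> k; rewrite distrC; apply: window_average => //.
    by have := dle k; have := d0 k; lra.
  move=> x /andP[ax xd]; rewrite distrC; apply: rf; rewrite /ball /= ler0_norm; last lra.
  suff : d k < r by lra.
  near: k.
  have := dlim => /cvgrPdist_lt /(_ r r0); apply: filterS => k.
  by rewrite sub0r normrN ger0_norm// ltW.
have limB : (fun k => \int[lebesgue_measure]_(x in `[a, b])
    (f x * window (b - d k) (d k) x)) @ \oo --> f b.
  apply/cvgrPdist_le => e e0.
  have := cf b => /cvgrPdist_le /(_ e e0) /nbhs_ballP[r /= r0 rf].
  near=> k; rewrite distrC; apply: window_average => //.
  - by have := dle k; have := d0 k; lra.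
  - by rewrite subrK.
  move=> x /andP[ax xd]; rewrite distrC; apply: rf; rewrite /ball /= ger0_norm; last lra.
  suff : d k < r by lra.
  near: k.
  have := dlim => /cvgrPdist_lt /(_ r r0); apply: filterS => k.
  by rewrite sub0r normrN ger0_norm// ltW.
have gIo : lebesgue_measure.-integrable `]a, b[ (EFin \o g).
  apply: integrableS (locally_integrable_itv a b lg) => //.
  by apply: subset_itv; rewrite bnd_simp.
have limG : (fun k => \int[lebesgue_measure]_(x in `]a, b[) (phi k x * g x)) @ \oo -->
     \int[lebesgue_measure]_(x in `]a, b[) g x.
  apply: fine_cvg; rewrite fineK; last exact: integrable_fin_num.
  apply: (@dominated_cvg _ _ R (@lebesgue_measure R) _ _
    (fun k x => (phi k x * g x)%:E) (EFin \o g) (fun x => `|g x|%:E)) => //.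
  - move=> k; apply/measurable_EFinP; apply: measurable_funM.
      by apply: measurable_funTS; exact: continuous_measurable_fun.
    by have [mg _ _] := lg; exact: measurable_funTS.
  - move=> x; rewrite /= in_itv /= => /andP[ax xb].
    apply: cvg_near_cst; near=> k; rewrite /phi cutoff_eq1 ?mul1r//.
      suff : d k < x - a by lra.
      near: k; have xa0 : 0 < x - a by lra.
      have := dlim => /cvgrPdist_lt /(_ _ xa0); apply: filterS => k.
      by rewrite sub0r normrN ger0_norm// ltW.
    suff : d k < b - x by lra.
    near: k; have xa0 : 0 < b - x by lra.
    have := dlim => /cvgrPdist_lt /(_ _ xa0); apply: filterS => k.
    by rewrite sub0r normrN ger0_norm// ltW.
  - exact: integrable_norm.
  - by move=> k x _; rewrite lee_fin normrM ler_piMl ?normr_ge0 ?norm_cutoff_le1.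
have lim1 : (fun k => - \int[lebesgue_measure]_(x in `]a, b[) (phi k x * g x)) @ \oo --> f a - f b.
  rewrite (_ : (fun k => _) = (fun k =>
    \int[lebesgue_measure]_(x in `[a, b]) (f x * window a (d k) x) -
    \int[lebesgue_measure]_(x in `[a, b]) (f x * window (b - d k) (d k) x))).
    exact: cvgB.
  by apply/funext => k; rewrite idk.
have E := cvg_unique _ lim1 (cvgN limG).
have -> : f b - f a = \int[lebesgue_measure]_(x in `]a, b[) g x.
  by apply: oppr_inj; rewrite opprB; exact: E.
rewrite Rintegral_itv_obnd_cbnd// Rintegral_itv_bndo_bndc//.
apply: integrableS (locally_integrable_itv a b lg) => //.
by apply: subset_itvl; rewrite bnd_simp.
Unshelve. all: by end_near. Qed.

(** * Weak derivatives: algebra, uniqueness, increments *)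

(** One real component of an element of H^1, together with a weak derivative. *)
Definition weak_deriv {R : realType} (f g : R -> R) : Prop :=
  [/\ continuous f, locally_integrable setT g & is_weak_derivative_real f g].

Lemma locally_integrable_of_itv (R : realType) (g : R -> R) :
  measurable_fun setT g ->
  (forall A, lebesgue_measure.-integrable `[- A, A] (EFin \o g)) ->
  locally_integrable setT g.
Proof.
move=> mg gi; split=> //; first exact: openT.
move=> K _ cK; have [M [_ HM]] := compact_bounded cK.
have /integrableP[mgA] := gi (M + 1); apply: le_lt_trans.
apply: ge0_subset_integral => //.
- exact: compact_measurable.
- by apply/measurable_EFinP; apply: measurableT_comp => //; exact: measurable_funTS.
- move=> x Kx /=; rewrite in_itv /= -ler_norml; apply: HM => //.
  by rewrite ltrDl.
Qed.

Lemma continuous_locally_integrable (R : realType) (f : R -> R) :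
  continuous f -> locally_integrable setT f.
Proof.
move=> cf; apply: locally_integrable_of_itv.
  exact: continuous_measurable_fun.
by move=> A; exact: continuous_integrable_itv.
Qed.

Lemma locally_integrable_mul (R : realType) (h g : R -> R) :
  continuous h -> locally_integrable setT g ->
  locally_integrable setT (fun x => h x * g x).
Proof.
move=> ch lg; apply: locally_integrable_of_itv.
  apply: measurable_funM; first exact: continuous_measurable_fun.
  by case: lg.
by move=> A; apply: integrable_mul_continuous => //; exact: locally_integrable_itv.
Qed.

Lemma C1c_continuous (R : realType) (phi : R -> R) : C1c phi -> continuous phi.
Proof.
by move=> [dphi _ _] x; apply: differentiable_continuous; apply/derivable1_diffP.
Qed.

Lemma C1c_is_derive (R : realType) (phi : R -> R) : C1c phi ->
  forall x : R, is_derive x 1 phi (derive1 phi x).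
Proof. by move=> [dphi _ _] x; rewrite derive1E; exact: derivableP. Qed.

Lemma continuousM_fun (R : realType) (f g : R -> R) :
  continuous f -> continuous g -> continuous (fun x => f x * g x).
Proof. by move=> cf cg x; apply: cvgM; [exact: cf|exact: cg]. Qed.

Lemma continuousD_fun (R : realType) (f g : R -> R) :
  continuous f -> continuous g -> continuous (fun x => f x + g x).
Proof. by move=> cf cg x; apply: cvgD; [exact: cf|exact: cg]. Qed.

Lemma continuousB_fun (R : realType) (f g : R -> R) :
  continuous f -> continuous g -> continuous (fun x => f x - g x).
Proof. by move=> cf cg x; apply: cvgB; [exact: cf|exact: cg]. Qed.

(** The seed from which the product rule produces all C^1 functions. *)
Lemma weak_deriv_cst1 (R : realType) : weak_deriv (cst (1 : R)) (cst 0).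
Proof.
split; [exact: cst_continuous|exact/continuous_locally_integrable/cst_continuous|].
move=> phi cphi; have [A A0 HA] := C1c_support cphi.
rewrite !(@Rintegral_support _ _ (- A) A); first last.
- by move=> x /HA[_ ->]; rewrite mulr0.
- by move=> x _; rewrite mul0r.
under eq_Rintegral do rewrite mul1r.
under [in RHS]eq_Rintegral do rewrite mul0r.
rewrite (FTC2_everywhere _ (C1c_is_derive cphi)); last 2 first.
- by rewrite ge0_cp// ltW.
- by case: cphi.
have [-> _] := HA A (or_intror (lexx _)).
have [-> _] := HA (- A) (or_introl (lexx _)).
by rewrite subrr /Rintegral integral0 /= oppr0.
Qed.

(** The product of c with a test function is again a test function. *)
Lemma weak_deriv_mul (R : realType) (c dc f g : R -> R) :
  (forall x : R, is_derive x 1 c (dc x)) -> continuous dc ->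
  weak_deriv f g ->
  weak_deriv (fun x => c x * f x) (fun x => c x * g x + dc x * f x).
Proof.
move=> cE cdc [cf lg wfg]; have cc := is_derive_continuous cE.
split; first exact: continuousM_fun.
  apply: locally_integrableD; first exact: locally_integrable_mul.
  by apply: continuous_locally_integrable; exact: continuousM_fun.
move=> phi cphi; have [A A0 HA] := C1c_support cphi.
have phi_cont := C1c_continuous cphi; have dphi := C1c_is_derive cphi.
have dphi_cont : continuous (derive1 phi) by case: cphi.
have cphiE (x : R) : is_derive x 1 (fun y => c y * phi y) (c x * derive1 phi x + dc x * phi x).
  rewrite [X in is_derive _ _ _ X](_ : _ = c x *: derive1 phi x + phi x *: dc x).
    exact: is_deriveM.
  by rewrite /GRing.scale /= [dc x * _]mulrC.
have dcont : continuous (fun x => c x * derive1 phi x + dc x * phi x).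
  by apply: continuousD_fun; exact: continuousM_fun.
have C1 : C1c (fun y => c y * phi y).
  apply: (C1c_of_itv (a := - A) (b := A) cphiE) => // x /HA[-> _].
  by rewrite mulr0.
have := wfg _ C1.
have -> : derive1 (fun y => c y * phi y) = (fun x => c x * derive1 phi x + dc x * phi x).
  by apply/funext => x; rewrite derive1E; have [] := cphiE x.
rewrite !(@Rintegral_support _ _ (- A) A);
  try by move=> x /HA[E1 E2]; rewrite ?E1 ?E2 ?mulr0 ?addr0 ?mulr0.
have I1 : lebesgue_measure.-integrable `[- A, A] (EFin \o (fun x => c x * f x * derive1 phi x)).
  by apply: continuous_integrable_itv; do !apply: continuousM_fun.
have I2 : lebesgue_measure.-integrable `[- A, A] (EFin \o (fun x => dc x * f x * phi x)).
  by apply: continuous_integrable_itv; do !apply: continuousM_fun.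
have I3 : lebesgue_measure.-integrable `[- A, A] (EFin \o (fun x => c x * phi x * g x)).
  apply: integrable_mul_continuous; first exact: continuousM_fun.
  exact: locally_integrable_itv.
have -> : \int[lebesgue_measure]_(x in `[- A, A]) (f x * (c x * derive1 phi x + dc x * phi x)) =
   \int[lebesgue_measure]_(x in `[- A, A]) (c x * f x * derive1 phi x) +
   \int[lebesgue_measure]_(x in `[- A, A]) (dc x * f x * phi x).
  by rewrite -RintegralD//; apply: eq_Rintegral => x _; ring.
have -> : \int[lebesgue_measure]_(x in `[- A, A]) ((c x * g x + dc x * f x) * phi x) =
   \int[lebesgue_measure]_(x in `[- A, A]) (c x * phi x * g x) +
   \int[lebesgue_measure]_(x in `[- A, A]) (dc x * f x * phi x).
  by rewrite -RintegralD//; apply: eq_Rintegral => x _; ring.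
have -> : \int[lebesgue_measure]_(x in `[- A, A]) (g x * (c x * phi x)) =
   \int[lebesgue_measure]_(x in `[- A, A]) (c x * phi x * g x).
  by apply: eq_Rintegral => x _; ring.
move=> /eqP; rewrite -subr_eq0 => /eqP E.
by apply/eqP; rewrite -subr_eq0; apply/eqP; rewrite -[RHS]E; ring.
Qed.

Lemma weak_deriv_C1 (R : realType) (c dc : R -> R) :
  (forall x : R, is_derive x 1 c (dc x)) -> continuous dc -> weak_deriv c dc.
Proof.
move=> cE cdc; have := weak_deriv_mul cE cdc (weak_deriv_cst1 R).
have -> : (fun x => c x * cst 1 x) = c by apply/funext => x; rewrite mulr1.
by have -> : (fun x => c x * cst 0 x + dc x * cst 1 x) = dc
  by apply/funext => x; rewrite mulr0 add0r mulr1.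
Qed.

Lemma weak_derivD (R : realType) (f1 g1 f2 g2 : R -> R) :
  weak_deriv f1 g1 -> weak_deriv f2 g2 ->
  weak_deriv (fun x => f1 x + f2 x) (fun x => g1 x + g2 x).
Proof.
move=> [cf1 lg1 w1] [cf2 lg2 w2]; split; first exact: continuousD_fun.
  exact: locally_integrableD.
move=> phi cphi; have [A A0 HA] := C1c_support cphi.
have phi_cont := C1c_continuous cphi.
have dphi_cont : continuous (derive1 phi) by case: cphi.
have := w2 _ cphi; have := w1 _ cphi.
rewrite !(@Rintegral_support _ _ (- A) A); try by move=> x /HA[E1 E2]; rewrite ?E1 ?E2 mulr0.
have If (f : R -> R) : continuous f ->
    lebesgue_measure.-integrable `[- A, A] (EFin \o (fun x => f x * derive1 phi x)).
  by move=> cf; apply: continuous_integrable_itv; exact: continuousM_fun.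
have Ig (g : R -> R) : locally_integrable setT g ->
    lebesgue_measure.-integrable `[- A, A] (EFin \o (fun x => g x * phi x)).
  move=> lg; have := integrable_mul_continuous phi_cont (locally_integrable_itv (- A) A lg).
  by congr (_ .-integrable _ (EFin \o _)); apply/funext => x; rewrite mulrC.
move=> E1 E2.
under eq_Rintegral do rewrite mulrDl.
under [in RHS]eq_Rintegral do rewrite mulrDl.
rewrite !RintegralD//; [|exact: Ig..|exact: If|exact: If].
by rewrite E1 E2 opprD.
Qed.

(** The difference of two weak derivatives has integral 0 over every [-1, x], hence
    vanishes almost everywhere by Lebesgue's differentiation theorem.  The base
    point -1 is chosen to the left of the period [0, 2 pi]. *)
Lemma weak_deriv_ae_unique (R : realType) (f g1 g2 : R -> R) :
  weak_deriv f g1 -> weak_deriv f g2 ->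
  {ae lebesgue_measure, forall x : R, -1 < x -> g1 x = g2 x}.
Proof.
move=> [cf lg1 w1] [_ lg2 w2]; have lg := locally_integrableB lg1 lg2.
pose g := fun x => g1 x - g2 x.
have gI y : lebesgue_measure.-integrable `[-1, y] (EFin \o g).
  exact: locally_integrable_itv.
have := FTC1 gI lg; apply: filterS.
  exact: (ae_filter_ringOfSetsType (@lebesgue_measure R)).
move=> x Hx x1.
have {Hx} := Hx ltac:(by rewrite lte_fin).
set F := (fun y : R => _); have -> : F = cst 0.
  apply/funext => y; rewrite /F /=.
  have [y1|y1] := leP (-1) y; last first.
    by rewrite set_itv_ge ?Rintegral_set0// bnd_simp -ltNge.
  rewrite /g RintegralB//; try exact: locally_integrable_itv.
  by rewrite -(weak_FTC cf lg1 w1)// -(weak_FTC cf lg2 w2)// subrr.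
move=> [_]; rewrite derive1_cst => /esym/eqP.
by rewrite subr_eq0 => /eqP.
Qed.

Lemma integrable_itvD (R : realType) (f g : R -> R) (a b : R) :
  lebesgue_measure.-integrable `[a, b] (EFin \o f) ->
  lebesgue_measure.-integrable `[a, b] (EFin \o g) ->
  lebesgue_measure.-integrable `[a, b] (EFin \o (fun x => f x + g x)).
Proof.
move=> fi gi.
rewrite (_ : _ \o _ = ((EFin \o f) \+ (EFin \o g))%E); last exact/funext.
exact: integrableD.
Qed.

(** The Cauchy-Schwarz inequality for the integral of g, obtained from the integral
    of (g - m)^2 where m is the mean of g. *)
Lemma weak_increment (R : realType) (f g : R -> R) (a b : R) :
  weak_deriv f g -> a <= b ->
  lebesgue_measure.-integrable `[a, b] (EFin \o (fun x => g x ^+ 2)) ->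
  (f b - f a) ^+ 2 <= (b - a) * \int[lebesgue_measure]_(x in `[a, b]) (g x ^+ 2).
Proof.
move=> [cf lg w]; rewrite le_eqVlt => /predU1P[->|ab] gI2.
  by rewrite !subrr expr0n mul0r.
have gI := locally_integrable_itv a b lg.
rewrite (weak_FTC cf lg w (ltW ab)).
set J := \int[_]_(_ in _) (g _ ^+ 2); set I := \int[_]_(_ in _) _.
have ba : 0 < b - a by rewrite subr_gt0.
pose m := I / (b - a).
have cI (k : R) : lebesgue_measure.-integrable `[a, b] (EFin \o (fun=> k)).
  by apply: continuous_integrable_itv; exact: cst_continuous.
have gmI : lebesgue_measure.-integrable `[a, b] (EFin \o (fun x => (- 2 * m) * g x)).
  by apply: integrable_mul_continuous => //; exact: cst_continuous.
have : 0 <= \int[lebesgue_measure]_(x in `[a, b]) (g x ^+ 2 + (- 2 * m) * g x + m ^+ 2).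
  apply: Rintegral_ge0 => x _; have := sqr_ge0 (g x - m); lra.
rewrite RintegralD//; last exact: integrable_itvD.
rewrite RintegralD// RintegralZl// -/J -/I.
rewrite Rintegral_cst//= lebesgue_measure_itv /= lte_fin ab /=.
have -> : J + -2 * m * I + m ^+ 2 * (b - a) = J - I ^+ 2 / (b - a).
  by rewrite /m; field; rewrite gt_eqF.
by rewrite subr_ge0 ler_pdivrMr// mulrC.
Qed.

(** * Wirtinger and chord inequalities for periodic functions *)

Definition period_integral {R : realType} (f : R -> R) : R :=
  \int[lebesgue_measure]_(x in `[0, 2 * pi]) f x.

Definition period_integrable {R : realType} (f : R -> R) : Prop :=
  lebesgue_measure.-integrable `[0, 2 * pi] (EFin \o f).

Definition period_L2 {R : realType} (g : R -> R) : Prop :=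
  measurable_fun setT g /\ period_integrable (fun x => g x ^+ 2).

Lemma period_integralD (R : realType) (f g : R -> R) : period_integrable f -> period_integrable g ->
  period_integral (fun x => f x + g x) = period_integral f + period_integral g.
Proof. by move=> fi gi; rewrite /period_integral RintegralD. Qed.

Lemma period_integralZ (R : realType) (c : R) (f : R -> R) : period_integrable f ->
  period_integral (fun x => c * f x) = c * period_integral f.
Proof. by move=> fi; rewrite /period_integral RintegralZl. Qed.

Lemma period_integrableD (R : realType) (f g : R -> R) :
  period_integrable f -> period_integrable g ->
  period_integrable (fun x => f x + g x).
Proof. exact: integrable_itvD. Qed.

Lemma period_integrableZ (R : realType) (c : R) (f : R -> R) : period_integrable f ->
  period_integrable (fun x => c * f x).
Proof. by move=> fi; apply: integrable_mul_continuous => //; exact: cst_continuous. Qed.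

Lemma period_integrable_le (R : realType) (f g : R -> R) :
  measurable_fun setT f -> period_integrable g ->
  (forall x, 0 <= f x <= g x) -> period_integrable f.
Proof.
move=> mf gi fg; apply: le_integrable gi => //.
  by apply/measurable_EFinP; exact: measurable_funTS.
move=> x _ /=; rewrite lee_fin.
have /andP[f0 fgx] := fg x; rewrite !ger0_norm//.
exact: le_trans fgx.
Qed.

Lemma period_L2_continuous (R : realType) (f : R -> R) : continuous f -> period_L2 f.
Proof.
move=> cf; split; first exact: continuous_measurable_fun.
by apply: continuous_integrable_itv; exact: sqr_continuous.
Qed.

Lemma period_L2D (R : realType) (f g : R -> R) : period_L2 f -> period_L2 g ->
  period_L2 (fun x => f x + g x).
Proof.
move=> [mf fi] [mg gi]; have mfg : measurable_fun setT (fun x => f x + g x).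
  exact: measurable_funD.
split=> //; apply: (@period_integrable_le _ _ (fun x => 2 * f x ^+ 2 + 2 * g x ^+ 2)).
- exact: measurable_funX.
- by apply: period_integrableD; exact: period_integrableZ.
- move=> x; rewrite sqr_ge0 /=; have := sqr_ge0 (f x - g x); lra.
Qed.

Lemma period_L2M (R : realType) (h g : R -> R) : continuous h -> period_L2 g ->
  period_L2 (fun x => h x * g x).
Proof.
move=> ch [mg gi]; split.
  by apply: measurable_funM => //; exact: continuous_measurable_fun.
have := integrable_mul_continuous (sqr_continuous ch) gi.
rewrite /period_integrable; congr (_ .-integrable _ (EFin \o _)).
by apply/funext => x; rewrite exprMn.
Qed.

Lemma energy_split (R : realType) (g : R -> R) (a b : R) : period_L2 g ->
  0 <= a -> a <= b -> b <= 2 * pi ->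
  \int[lebesgue_measure]_(x in `[0, b]) (g x ^+ 2) -
    \int[lebesgue_measure]_(x in `[0, a]) (g x ^+ 2)
  = \int[lebesgue_measure]_(x in `[a, b]) (g x ^+ 2).
Proof.
move=> [_ gi] a0 ab b2; rewrite (@Rintegral_chasles _ _ 0 a b)//.
  by rewrite addrC addKr.
by apply: integrableS gi => //; apply: subset_itvl; rewrite bnd_simp.
Qed.

Lemma energy_increments (R : realType) (f g : R -> R) (a b : R) :
  weak_deriv f g -> period_L2 g -> 0 <= a -> a <= b -> b <= 2 * pi ->
  (f b - f a) ^+ 2 <= (b - a) *
    (\int[lebesgue_measure]_(x in `[0, b]) (g x ^+ 2) -
     \int[lebesgue_measure]_(x in `[0, a]) (g x ^+ 2)).
Proof.
move=> wf gs a0 ab b2; rewrite energy_split//; apply: weak_increment => //.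
by case: gs => _ gi; apply: integrableS gi => //; apply: subset_itv; rewrite bnd_simp.
Qed.

Lemma energy_mono (R : realType) (g : R -> R) (a b : R) : period_L2 g ->
  0 <= a -> a <= b -> b <= 2 * pi ->
  \int[lebesgue_measure]_(x in `[0, a]) (g x ^+ 2)
    <= \int[lebesgue_measure]_(x in `[0, b]) (g x ^+ 2).
Proof.
move=> gs a0 ab b2; rewrite -subr_ge0 energy_split//.
by apply: Rintegral_ge0 => x _; exact: sqr_ge0.
Qed.

Lemma wirtinger_antiperiodic (R : realType) (f g : R -> R) :
  weak_deriv f g -> period_L2 g -> (forall x, f (x + 2 * pi) = - f x) ->
  period_integral (fun x => f x ^+ 2) <= 4 * period_integral (fun x => g x ^+ 2).
Proof.
move=> wf gs fpi; have [cf _ _] := wf.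
have := wirtinger_of_increments cf fpi
  (fun a b => @energy_mono R g a b gs) (fun a b => @energy_increments R f g a b wf gs).
by rewrite set_itv1 Rintegral_set1 subr0.
Qed.

Lemma chord_inequality (R : realType) (n h : nat) (f g : R -> R) :
  (1 < n)%N -> (h <= n)%N ->
  weak_deriv f g -> period_L2 g -> (forall x, f (x + 2 * pi) = f x) ->
  period_integral (fun x => (f (x + h%:R * tau n) - f x) ^+ 2)
    <= 4 * sin (pi / n%:R * h%:R) ^+ 2 * period_integral (fun x => g x ^+ 2).
Proof.
move=> n1 hn wf gs fpi; have [cf _ _] := wf.
have := chord_of_increments cf fpi n1 hn
  (fun a b => @energy_mono R g a b gs) (fun a b => @energy_increments R f g a b wf gs).
by rewrite set_itv1 Rintegral_set1 subr0.
Qed.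

Lemma is_derive_cos_scaled (R : realType) (k x : R) :
  is_derive x 1 (fun y => cos (k * y)) (- k * sin (k * x)).
Proof.
rewrite [X in is_derive _ _ _ X](_ : _ = - sin (k * x) * k); last by ring.
apply: (@is_derive1_comp _ cos (fun y => k * y)).
rewrite -[X in is_derive _ _ _ X]mulr1.
exact: (@is_deriveZ _ _ _ id).
Qed.

Lemma is_derive_sin_scaled (R : realType) (k x : R) :
  is_derive x 1 (fun y => sin (k * y)) (k * cos (k * x)).
Proof.
rewrite [X in is_derive _ _ _ X](_ : _ = cos (k * x) * k); last by ring.
apply: (@is_derive1_comp _ sin (fun y => k * y)).
rewrite -[X in is_derive _ _ _ X]mulr1.
exact: (@is_deriveZ _ _ _ id).
Qed.

Lemma continuous_cos_scaled (R : realType) (k : R) : continuous (fun y => cos (k * y)).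
Proof. exact: is_derive_continuous (is_derive_cos_scaled k). Qed.

Lemma continuous_sin_scaled (R : realType) (k : R) : continuous (fun y => sin (k * y)).
Proof. exact: is_derive_continuous (is_derive_sin_scaled k). Qed.

Lemma continuousZ_fun (R : realType) (k : R) (f : R -> R) :
  continuous f -> continuous (fun y => k * f y).
Proof. by move=> cf; apply: continuousM_fun => //; exact: cst_continuous. Qed.

(** For a half-integer k the two components of e^(ikt) (a + i b) are antiperiodic, and
    the derivative of this function has modulus |(p + i q) + i k (a + i b)|.  On the
    Fourier mode e^(ijt) the inequality says that (j + k)^2 >= 1/4. *)
Lemma rotated_wirtinger (R : realType) (k : R) (a b p q : R -> R) :
  cos (k * (2 * pi)) = -1 -> sin (k * (2 * pi)) = 0 ->
  (forall x, a (x + 2 * pi) = a x) -> (forall x, b (x + 2 * pi) = b x) ->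
  weak_deriv a p -> weak_deriv b q -> period_L2 p -> period_L2 q ->
  period_integral (fun x => a x ^+ 2 + b x ^+ 2)
    <= 4 * period_integral (fun x => (p x - k * b x) ^+ 2 + (q x + k * a x) ^+ 2).
Proof.
move=> ck sk api bpi wa wb ps qs; have [ca _ _] := wa; have [cb _ _] := wb.
have cc := @continuous_cos_scaled R k; have cs := @continuous_sin_scaled R k.
have cpi x : cos (k * (x + 2 * pi)) = - cos (k * x).
  by rewrite mulrDr cosD ck sk; ring.
have spi x : sin (k * (x + 2 * pi)) = - sin (k * x).
  by rewrite mulrDr sinD ck sk; ring.
pose v x := p x + (- k) * b x; pose w x := q x + k * a x.
have vs : period_L2 v.
  by apply: period_L2D => //; apply: period_L2_continuous; exact: continuousZ_fun.
have ws : period_L2 w.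
  by apply: period_L2D => //; apply: period_L2_continuous; exact: continuousZ_fun.
have dcosc : continuous (fun y : R => - k * sin (k * y)) by exact: continuousZ_fun.
have dsinc : continuous (fun y : R => k * cos (k * y)) by exact: continuousZ_fun.
have wca := weak_deriv_mul (is_derive_cos_scaled k) dcosc wa.
have wsa := weak_deriv_mul (is_derive_sin_scaled k) dsinc wa.
have wcb := weak_deriv_mul (is_derive_cos_scaled k) dcosc wb.
have wsb := weak_deriv_mul (is_derive_sin_scaled k) dsinc wb.
have wN (f g : R -> R) : weak_deriv f g -> weak_deriv (fun x => - f x) (fun x => - g x).
  move=> wf; have dN (x : R) : is_derive x 1 (cst (- 1 : R)) (cst 0 x).
    exact: is_derive_cst.
  have := weak_deriv_mul dN (@cst_continuous _ _ _) wf.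
  rewrite (_ : (fun x => cst (-1) x * f x) = (fun x => - f x)); last first.
    by apply/funext => x; rewrite mulN1r.
  rewrite (_ : (fun x => _ + _) = (fun x => - g x))//.
  by apply/funext => x; rewrite mulN1r mul0r addr0.
have w1 := weak_derivD wca (wN _ _ wsb).
have w2 := weak_derivD wsa wcb.
have e1 : (fun x => cos (k * x) * p x + - k * sin (k * x) * a x +
      - (sin (k * x) * q x + k * cos (k * x) * b x)) =
    (fun x => cos (k * x) * v x + - sin (k * x) * w x).
  by apply/funext => x; rewrite /v /w; ring.
have e2 : (fun x => sin (k * x) * p x + k * cos (k * x) * a x +
      (cos (k * x) * q x + - k * sin (k * x) * b x)) =
    (fun x => sin (k * x) * v x + cos (k * x) * w x).
  by apply/funext => x; rewrite /v /w; ring.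
rewrite e1 in w1; rewrite e2 in w2.
have s1 : period_L2 (fun x => cos (k * x) * v x + - sin (k * x) * w x).
  by apply: period_L2D; apply: period_L2M => // x; apply: cvgN; exact: cs.
have s2 : period_L2 (fun x => sin (k * x) * v x + cos (k * x) * w x).
  by apply: period_L2D; exact: period_L2M.
have W1 := wirtinger_antiperiodic w1 s1 ltac:(by move=> x /=; rewrite cpi spi api bpi; ring).
have W2 := wirtinger_antiperiodic w2 s2 ltac:(by move=> x /=; rewrite cpi spi api bpi; ring).
have [_ i1] := s1; have [_ i2] := s2.
have [_ i3] : period_L2 (fun x => cos (k * x) * a x + - (sin (k * x) * b x)).
  by apply: period_L2_continuous; case: w1.
have [_ i4] : period_L2 (fun x => sin (k * x) * a x + cos (k * x) * b x).
  by apply: period_L2_continuous; case: w2.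
have := lerD W1 W2; rewrite -mulrDr -!period_integralD//.
rewrite (_ : (fun x => (cos (k * x) * a x + - (sin (k * x) * b x)) ^+ 2 +
   (sin (k * x) * a x + cos (k * x) * b x) ^+ 2) = (fun x => a x ^+ 2 + b x ^+ 2)); last first.
  apply/funext => x; have := sin2cos2 (k * x).
  by set c := cos _; set s := sin _ => E; ring: E.
rewrite (_ : (fun x => (cos (k * x) * v x + - sin (k * x) * w x) ^+ 2 +
   (sin (k * x) * v x + cos (k * x) * w x) ^+ 2) =
   (fun x => (p x - k * b x) ^+ 2 + (q x + k * a x) ^+ 2))//.
apply/funext => x; have := sin2cos2 (k * x); rewrite /v /w.
by set c := cos _; set s := sin _ => E; ring: E.
Qed.

(** On the Fourier mode e^(ijt) the inequality to be proved is
    (j + omega)^2 >= (omega - 1)^2 j^2.  With th = 3 omega/4, in [0, 1], the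
    difference of the two sides is
      omega ((1 - th) 2 j (j + 1) + th (2/3) (j + 1) (j + 2)),
    and j (j + 1) = (j + 1/2)^2 - 1/4, (j + 1) (j + 2) = (j + 3/2)^2 - 1/4.  So the
    bound is a nonnegative combination of the rotated Wirtinger inequalities for
    k = 1/2 and k = 3/2. *)
Lemma kinetic_bound (R : realType) (omega : R) (a b p q : R -> R) :
  0 < omega -> omega <= 4 / 3 ->
  (forall x, a (x + 2 * pi) = a x) -> (forall x, b (x + 2 * pi) = b x) ->
  weak_deriv a p -> weak_deriv b q -> period_L2 p -> period_L2 q ->
  (omega - 1) ^+ 2 * period_integral (fun x => p x ^+ 2 + q x ^+ 2)
    <= period_integral (fun x => (p x - omega * b x) ^+ 2 + (q x + omega * a x) ^+ 2).
Proof.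
move=> o0 o1 api bpi wa wb ps qs; have [ca _ _] := wa; have [cb _ _] := wb.
have h1 := @rotated_wirtinger R (1/2) a b p q
  ltac:(by rewrite (_ : 1/2 * (2 * pi) = pi) ?cospi//; lra)
  ltac:(by rewrite (_ : 1/2 * (2 * pi) = pi) ?sinpi//; lra) api bpi wa wb ps qs.
have h2 := @rotated_wirtinger R (3/2) a b p q
  ltac:(by rewrite (_ : 3/2 * (2 * pi) = pi + pi *+ 2) ?cosD2pi ?cospi//; lra)
  ltac:(by rewrite (_ : 3/2 * (2 * pi) = pi + pi *+ 2) ?sinD2pi ?sinpi//; lra) api bpi wa wb ps qs.
have Is k : period_integrable (fun x => (p x - k * b x) ^+ 2 + (q x + k * a x) ^+ 2).
  apply: period_integrableD.
    have [//] : period_L2 (fun x => p x + (- (k * b x))).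
    apply: period_L2D => //; apply: period_L2_continuous => x.
    by apply: cvgN; exact: continuousZ_fun.
  have [//] : period_L2 (fun x => q x + k * a x).
  by apply: period_L2D => //; apply: period_L2_continuous; exact: continuousZ_fun.
have Iab : period_integrable (fun x => a x ^+ 2 + b x ^+ 2).
  by apply: period_integrableD; apply: continuous_integrable_itv; exact: sqr_continuous.
have Ipq : period_integrable (fun x => p x ^+ 2 + q x ^+ 2).
  by apply: period_integrableD; [case: ps|case: qs].
pose th := 3 * omega / 4; pose c1 := omega * (2 * (1 - th)); pose c2 := omega * (2 / 3 * th).
have c10 : 0 <= c1 by rewrite mulr_ge0 ?(ltW o0)//; rewrite /th; lra.
have c20 : 0 <= c2 by rewrite mulr_ge0 ?(ltW o0)//; rewrite /th; lra.
pose K w x := (p x - w * b x) ^+ 2 + (q x + w * a x) ^+ 2.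
pose M x := a x ^+ 2 + b x ^+ 2; pose E x := p x ^+ 2 + q x ^+ 2.
have I1 : period_integrable (fun x => c1 * K (1/2) x) by exact: (period_integrableZ c1 (Is (1/2))).
have I2 : period_integrable (fun x => c2 * K (3/2) x) by exact: (period_integrableZ c2 (Is (3/2))).
have I3 : period_integrable (fun x => (omega - 1) ^+ 2 * E x) by exact: (period_integrableZ _ Ipq).
have I4 : period_integrable (fun x => (c1 / 4 + c2 / 4) * M x) by exact: (period_integrableZ _ Iab).
have : period_integral (fun x => K omega x + (c1 / 4 + c2 / 4) * M x) =
   period_integral (fun x => (omega - 1) ^+ 2 * E x + (c1 * K (1/2) x + c2 * K (3/2) x)).
  by congr period_integral; apply/funext => x; rewrite /K /M /E /c1 /c2 /th; field.
rewrite (period_integralD (Is omega) I4).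
rewrite (period_integralD I3 (period_integrableD I1 I2)) (period_integralD I1 I2).
rewrite (period_integralZ _ Iab) (period_integralZ _ Ipq).
rewrite (period_integralZ _ (Is (1/2))) (period_integralZ _ (Is (3/2))).
have := ler_wpM2l c10 h1; have := ler_wpM2l c20 h2.
rewrite -/(M) -/(E) -/(K _).
lra.
Qed.

(** * The two parts of the action *)

(** The function s^(- alpha/2) is convex, hence above its tangent at s = rho0^2.  In
    the variable s = ln rho - ln rho0 this follows from 1 + x <= e^x, taken at
    x = - alpha s and at x = 2 s. *)
Lemma powR_tangent (R : realType) (rho rho0 alpha : R) :
  0 < rho -> 0 < rho0 -> 0 < alpha ->
  rho0 `^ (- alpha) * (1 + alpha / 2) <=
  1 / (rho `^ alpha) + alpha / 2 * rho0 `^ (- alpha) / rho0 ^+ 2 * rho ^+ 2.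
Proof.
move=> rho_gt0 rho0_gt0 alpha_gt0; pose s := ln rho - ln rho0.
have rhoE : rho = rho0 * expR s.
  by rewrite /s expRD expRN !lnK ?posrE// mulrCA divff ?mulr1// gt_eqF.
have -> : 1 / rho `^ alpha = rho0 `^ (- alpha) * expR (- alpha * s).
  rewrite div1r -powRN /powR !gt_eqF// -expRD; congr expR.
  by rewrite /s; ring.
have -> : alpha / 2 * rho0 `^ (- alpha) / rho0 ^+ 2 * rho ^+ 2 =
    rho0 `^ (- alpha) * (alpha / 2 * expR (2 * s)).
  have -> : expR (2 * s) = expR s ^+ 2.
    by rewrite expr2 -expRD; congr expR; ring.
  by rewrite rhoE; field; rewrite gt_eqF.
rewrite -mulrDr ler_wpM2l ?powR_ge0//.
have := expR_ge1Dx (- alpha * s).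
have a2 : 0 <= alpha / 2 by lra.
have := ler_wpM2l a2 (expR_ge1Dx (2 * s)).
lra.
Qed.

Lemma integral_cst_period (R : realType) (c : R) :
  (\int[lebesgue_measure]_(x in `[0%R, (2 * pi)%R]) c%:E = (c * (2 * pi))%:E)%E.
Proof.
have pi0 := pi_gt0 R.
rewrite (integral_cst _ _ c%:E)//= lebesgue_measure_itv /= lte_fin mulr_gt0//.
by rewrite sube0 -EFinM.
Qed.

Lemma integral_EFin_period (R : realType) (f : R -> R) : period_integrable f ->
  (\int[lebesgue_measure]_(x in `[0%R, (2 * pi)%R]) (f x)%:E = (period_integral f)%:E)%E.
Proof.
by move=> fi; rewrite /period_integral /Rintegral fineK//; exact: integrable_fin_num.
Qed.

(** The tangent bound is affine in rho^2, so it can be integrated and leaves only the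
    mean of rho^2. *)
Lemma potential_ge (R : realType) (rho : R -> R) (rho0 alpha : R) :
  continuous rho -> (forall x, 0 < rho x) -> 0 < rho0 -> 0 < alpha ->
  ((rho0 `^ (- alpha) * (2 * pi * (1 + alpha / 2)
      - alpha / 2 / rho0 ^+ 2 * period_integral (fun x => rho x ^+ 2)))%:E <=
   \int[lebesgue_measure]_(x in `[0%R, (2 * pi)%R]) (1 / (rho x `^ alpha))%:E)%E.
Proof.
move=> crho rho_gt0 rho00 alpha0.
set k := alpha / 2 * rho0 `^ (- alpha) / rho0 ^+ 2.
have k0 : 0 <= k by rewrite !mulr_ge0 ?invr_ge0 ?sqr_ge0 ?powR_ge0 ?(ltW alpha0).
have Irho : period_integrable (fun x => k * rho x ^+ 2).
  by apply: period_integrableZ; apply: continuous_integrable_itv; exact: sqr_continuous.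
have m1 : measurable_fun setT (fun x => 1 / (rho x `^ alpha)).
  rewrite (_ : (fun x => _) = (fun x => rho x `^ (- alpha))); last first.
    by apply/funext => x; rewrite powRN div1r.
  apply: (measurableT_comp (@measurable_powR R (- alpha))).
  exact: continuous_measurable_fun.
have : ((rho0 `^ (- alpha) * (1 + alpha / 2) * (2 * pi))%:E <=
   \int[lebesgue_measure]_(x in `[0%R, (2 * pi)%R]) (1 / (rho x `^ alpha))%:E +
   \int[lebesgue_measure]_(x in `[0%R, (2 * pi)%R]) (k * rho x ^+ 2)%:E)%E.
  rewrite -integral_cst_period -ge0_integralD//.
  - apply: ge0_le_integral => //.
    + by move=> x _; rewrite lee_fin mulr_ge0 ?powR_ge0//; lra.
    + apply/measurable_EFinP; apply: measurable_funTS; apply: measurable_funD => //.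
      by apply: measurable_funM => //; apply: measurable_funX; exact: continuous_measurable_fun.
    + by move=> x _; rewrite -EFinD lee_fin; exact: powR_tangent.
  - by move=> x _; rewrite lee_fin divr_ge0// powR_ge0.
  - by apply/measurable_EFinP; exact: measurable_funTS.
  - by move=> x _; rewrite lee_fin mulr_ge0// sqr_ge0.
  - apply/measurable_EFinP; apply: measurable_funTS.
    by apply: measurable_funM => //; apply: measurable_funX; exact: continuous_measurable_fun.
rewrite (integral_EFin_period Irho) period_integralZ; last first.
  by apply: continuous_integrable_itv; exact: sqr_continuous.
rewrite -leeBlDr// -EFinB; apply: le_trans; rewrite lee_fin /k.
rewrite le_eqVlt; apply/orP; left; apply/eqP; ring.
Qed.

Lemma normc_sqr (R : realType) (z : R[i]) :
  normc z ^+ 2 = complex.Re z ^+ 2 + complex.Im z ^+ 2.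
Proof. by case: z => a b /=; rewrite sqr_sqrtr// addr_ge0// sqr_ge0. Qed.

Lemma normc_rotating (R : realType) (v y : R[i]) (omega : R) :
  normc (v + 'i%C * (omega%:C)%C * y) ^+ 2 =
  (complex.Re v - omega * complex.Im y) ^+ 2 + (complex.Im v + omega * complex.Re y) ^+ 2.
Proof. by rewrite normc_sqr; case: v => p q; case: y => a b /=; ring. Qed.

Lemma normc_diff (R : realType) (y z : R[i]) :
  normc (y - z) ^+ 2 = (complex.Re y - complex.Re z) ^+ 2 + (complex.Im y - complex.Im z) ^+ 2.
Proof. by rewrite normc_sqr; case: y => p q; case: z => a b /=. Qed.

Lemma normc_nonneg (R : realType) (z : R[i]) : 0 <= normc z.
Proof. by case: z => a b /=; exact: sqrtr_ge0. Qed.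

Lemma action_kinetic_pinfty (R : realType) (n : nat) (alpha omega : R) (z : R -> R[i]) :
  (\int[lebesgue_measure]_(t in `[0%R, (2 * pi)%R])
       (normc (weak_derivative z t + 'i%C * (omega%:C)%C * z t) ^+ 2)%:E = +oo)%E ->
  action n alpha omega z = +oo%E.
Proof.
rewrite /action => ->; rewrite gt0_muley ?lte_fin ?invr_gt0//.
rewrite addye// gt_eqF// (@lt_le_trans _ _ 0%E)//.
apply: mule_ge0; first by rewrite lee_fin invr_ge0.
apply: sume_ge0 => h _; apply: integral_ge0 => x _.
by rewrite lee_fin divr_ge0// powR_ge0.
Qed.

(** * The lower bound *)

(** The distance between two vertices, h apart, of the regular n-gon of radius r. *)
Definition polygon_chord {R : realType} (n : nat) (r : R) (h : nat) : R :=
  2 * r * sin (pi / n%:R * h%:R).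

Definition polygon_potential {R : realType} (n : nat) (alpha r : R) : R :=
  \sum_(1 <= h < n) polygon_chord n r h `^ (- alpha).

Lemma polygon_chord_gt0 (R : realType) (n h : nat) (r : R) :
  (1 <= h < n)%N -> 0 < r -> 0 < polygon_chord n r h.
Proof.
move=> /andP[h1 hn] r0; have n0 : (0 < n)%N by exact: leq_trans hn.
have nR : 0 < n%:R :> R by rewrite ltr0n.
rewrite /polygon_chord mulr_gt0//; first by rewrite mulr_gt0.
apply: sin_gt0_pi; rewrite mulr_gt0 ?divr_gt0 ?pi_gt0 ?ltr0n//=.
by rewrite mulrAC ltr_pdivrMr// ltr_pM2l ?pi_gt0// ltr_nat.
Qed.

Lemma polygon_potential_gt0 (R : realType) (n : nat) (alpha r : R) :
  (2 <= n)%N -> 0 < r -> 0 < polygon_potential n alpha r.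
Proof.
move=> n2 r0; rewrite /polygon_potential big_ltn//.
rewrite ltr_pwDl ?powR_gt0 ?polygon_chord_gt0//.
by rewrite sumr_ge0// => h _; exact: powR_ge0.
Qed.

Lemma polygon_potential_scale (R : realType) (n : nat) (alpha r : R) :
  0 < r -> polygon_potential n alpha r = r `^ (- alpha) * polygon_potential n alpha 1.
Proof.
move=> r0; rewrite /polygon_potential mulr_sumr; apply: eq_big_nat => h hn.
rewrite -powRM ?(ltW r0) ?ltW ?polygon_chord_gt0//.
by congr (_ `^ _); rewrite /polygon_chord; ring.
Qed.

(** The solution r of (omega - 1)^2 r^2 = (alpha/2) polygon_potential n alpha r, the
    equation of the critical points of the action among the circles r e^(-it). *)
Definition critical_radius {R : realType} (n : nat) (alpha omega : R) : R :=
  (alpha / 2 * polygon_potential n alpha 1 / (omega - 1) ^+ 2) `^ (alpha + 2)^-1.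

Lemma critical_radius_gt0 (R : realType) (n : nat) (alpha omega : R) :
  (2 <= n)%N -> 0 < alpha -> omega <> 1 -> 0 < critical_radius n alpha omega.
Proof.
move=> n2 a0 o1; have o : 0 < (omega - 1) ^+ 2.
  by rewrite exprn_even_gt0//= subr_eq0; apply/eqP.
by rewrite powR_gt0// divr_gt0// mulr_gt0// ?polygon_potential_gt0//; lra.
Qed.

Lemma critical_radiusP (R : realType) (n : nat) (alpha omega : R) :
  (2 <= n)%N -> 0 < alpha -> omega <> 1 ->
  let r := critical_radius n alpha omega in
  (omega - 1) ^+ 2 * r ^+ 2 = alpha / 2 * polygon_potential n alpha r.
Proof.
move=> n2 a0 o1 r; have r0 : 0 < r by exact: critical_radius_gt0.
have o : 0 < (omega - 1) ^+ 2.
  by rewrite exprn_even_gt0//= subr_eq0; apply/eqP.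
have S0 := @polygon_potential_gt0 R n alpha 1 n2 ltr01.
set X := alpha / 2 * polygon_potential n alpha 1 / (omega - 1) ^+ 2.
have X0 : 0 <= X.
  by apply: divr_ge0; [apply: mulr_ge0; [lra|exact: ltW]|exact: ltW].
have rX : r `^ (alpha + 2) = X.
  rewrite /r /critical_radius -/X -powRrM mulVf ?powRr1//.
  by rewrite gt_eqF//; lra.
rewrite polygon_potential_scale//.
have -> : r ^+ 2 = r `^ (- alpha) * r `^ (alpha + 2).
  rewrite -powRD; last by rewrite (gt_eqF r0) implybT.
  by rewrite addrA addNr add0r powR_mulrn// ltW.
by rewrite rX /X; field; rewrite subr_eq0; apply/eqP.
Qed.

Lemma continuous_shift_tau (R : realType) (n h : nat) (f : R -> R) :
  continuous f -> continuous (fun x => f (x + h%:R * tau n)).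
Proof.
move=> cf x; apply: (@continuous_comp _ _ _ (fun y => y + h%:R * tau n) f).
  by apply: cvgD; [exact: cvg_id|exact: cvg_cst].
exact: cf.
Qed.

(** The potential of each chord is bounded below by its tangent at the chord of the
    regular n-gon, and the mean squared chord is bounded by the energy E, the
    integral of |z'|^2.  What is left is affine in E.  Its slope is the difference of
    the two sides of the equation for r, so it is 0, and only a constant remains. *)
Lemma action_ge (R : realType) (n : nat) (alpha omega r : R) (z : R -> R[i]) :
  (2 <= n)%N -> 0 < alpha -> 0 < omega -> omega <= 4 / 3 -> 0 < r ->
  (omega - 1) ^+ 2 * r ^+ 2 = alpha / 2 * polygon_potential n alpha r ->
  Lambda n z ->
  ((pi * (1 + alpha / 2) * polygon_potential n alpha r)%:E <= action n alpha omega z)%E.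
Proof.
move=> n2 alpha0 omega0 omega43 r0 req [[ca cb zpi _ [v0 wv0 _]] zcol].
set a := fun t => complex.Re (z t) in ca; set b := fun t => complex.Im (z t) in cb.
have [Lv wp wq] : is_weak_derivative z (weak_derivative z).
  by apply: (@xgetPex _ _ [set v | is_weak_derivative z v]); exists v0.
pose p t := complex.Re (weak_derivative z t); pose q t := complex.Im (weak_derivative z t).
have wa : weak_deriv a p by split=> //; case: Lv.
have wb : weak_deriv b q by split=> //; case: Lv.
have api x : a (x + 2 * pi) = a x by rewrite /a zpi.
have bpi x : b (x + 2 * pi) = b x by rewrite /b zpi.
have mp : measurable_fun setT p by case: wa => _ [].
have mq : measurable_fun setT q by case: wb => _ [].
pose K t := (p t - omega * b t) ^+ 2 + (q t + omega * a t) ^+ 2.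
have Kint : (\int[lebesgue_measure]_(t in `[0%R, (2 * pi)%R])
       (normc (weak_derivative z t + 'i%C * (omega%:C)%C * z t) ^+ 2)%:E =
    \int[lebesgue_measure]_(t in `[0%R, (2 * pi)%R]) (K t)%:E)%E.
  by apply: eq_integral => t _; rewrite normc_rotating.
have mb := continuous_measurable_fun cb; have ma := continuous_measurable_fun ca.
have mK : measurable_fun setT K.
  apply: measurable_funD; apply: measurable_funX.
    by apply: measurable_funB => //; exact: measurable_funM.
  by apply: measurable_funD => //; exact: measurable_funM.
have K0 t : 0 <= K t by rewrite addr_ge0 ?sqr_ge0.
have [Koo|Klt] := eqVneq (\int[lebesgue_measure]_(t in `[0%R, (2 * pi)%R]) (K t)%:E)%E +oo%E.
  by rewrite action_kinetic_pinfty ?leey// Kint.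
have KI : period_integrable K.
  apply/integrableP; split; first by apply/measurable_EFinP; exact: measurable_funTS.
  rewrite (_ : (\int[_]_(x in _) _)%E =
    (\int[lebesgue_measure]_(t in `[0%R, (2 * pi)%R]) (K t)%:E)%E) ?ltey//.
  by apply: eq_integral => t _ /=; rewrite ger0_norm.
have [_ sa] := period_L2_continuous ca; have [_ sb] := period_L2_continuous cb.
have sp : period_L2 p.
  split=> //; apply: (@period_integrable_le _ _ (fun x => 2 * K x + 2 * omega ^+ 2 * b x ^+ 2)).
  - exact: measurable_funX.
  - by apply: period_integrableD; exact: period_integrableZ.
  - move=> x; rewrite sqr_ge0 /= /K.
    have := sqr_ge0 (p x - 2 * omega * b x); have := sqr_ge0 (q x + omega * a x); lra.
have sq : period_L2 q.
  split=> //; apply: (@period_integrable_le _ _ (fun x => 2 * K x + 2 * omega ^+ 2 * a x ^+ 2)).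
  - exact: measurable_funX.
  - by apply: period_integrableD; exact: period_integrableZ.
  - move=> x; rewrite sqr_ge0 /= /K.
    have := sqr_ge0 (q x + 2 * omega * a x); have := sqr_ge0 (p x - omega * b x); lra.
have kin := kinetic_bound omega0 omega43 api bpi wa wb sp sq.
set E := period_integral _ in kin; rewrite -/K in kin.
have EE : E = period_integral (fun x => p x ^+ 2) + period_integral (fun x => q x ^+ 2).
  by rewrite /E period_integralD//; [case: sp|case: sq].
have nR : 0 < n%:R :> R by rewrite ltr0n ltnW.
have pot h : (1 <= h < n)%N ->
    ((polygon_chord n r h `^ (- alpha) * (2 * pi * (1 + alpha / 2) - alpha / 2 / r ^+ 2 * E))%:E <=
     \int[lebesgue_measure]_(t in `[0%R, (2 * pi)%R])
         (1 / (normc (z t - z (t + h%:R * tau n)) `^ alpha))%:E)%E.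
  move=> hn; have c0 := @polygon_chord_gt0 R n h r hn r0.
  pose rho t := normc (z t - z (t + h%:R * tau n)).
  have rhoE t : rho t ^+ 2 = (a (t + h%:R * tau n) - a t) ^+ 2 + (b (t + h%:R * tau n) - b t) ^+ 2.
    rewrite /rho normc_diff -/(a t) -/(b t) -/(a (t + _)) -/(b (t + _)); ring.
  have rho0 t : 0 < rho t.
    rewrite lt_neqAle normc_nonneg andbT eq_sym; apply/eqP => /eq0_normc /eqP.
    by rewrite subr_eq0 => /eqP; exact: zcol.
  have cda : continuous (fun t => a (t + h%:R * tau n) - a t).
    by apply: continuousB_fun => //; exact: continuous_shift_tau.
  have cdb : continuous (fun t => b (t + h%:R * tau n) - b t).
    by apply: continuousB_fun => //; exact: continuous_shift_tau.
  have crho : continuous rho.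
    pose rho2 t := (a (t + h%:R * tau n) - a t) ^+ 2 + (b (t + h%:R * tau n) - b t) ^+ 2.
    rewrite (_ : rho = (fun t => Num.sqrt (rho2 t))).
      move=> x; apply: (@continuous_comp _ _ _ rho2 Num.sqrt).
        by apply: continuousD_fun; exact: sqr_continuous.
      exact: sqrt_continuous.
    by apply/funext => t; rewrite /rho2 -rhoE sqrtr_sqr ger0_norm// ltW.
  apply: le_trans (potential_ge crho rho0 c0 alpha0).
  rewrite lee_fin ler_wpM2l ?powR_ge0// lerD2l lerN2.
  have hn' : (h <= n)%N by case/andP: hn => _ /ltnW.
  have A := chord_inequality n2 hn' wa sp api.
  have B := chord_inequality n2 hn' wb sq bpi.
  have -> : period_integral (fun t => rho t ^+ 2) =
      period_integral (fun t => (a (t + h%:R * tau n) - a t) ^+ 2)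
      + period_integral (fun t => (b (t + h%:R * tau n) - b t) ^+ 2).
    rewrite -period_integralD; try by apply: continuous_integrable_itv; exact: sqr_continuous.
    by congr period_integral; apply/funext => t; rewrite rhoE.
  have c20 : 0 <= alpha / 2 / polygon_chord n r h ^+ 2.
    by rewrite !mulr_ge0 ?invr_ge0 ?sqr_ge0 ?(ltW alpha0).
  have := ler_wpM2l c20 (lerD A B); rewrite -mulrDr -EE => /le_trans; apply.
  rewrite le_eqVlt; apply/orP; left; apply/eqP; rewrite /polygon_chord.
  have s0 : sin (pi / n%:R * h%:R) != 0 :> R.
    by apply: contraTneq c0; rewrite /polygon_chord => ->; rewrite mulr0 ltxx.
  by field; rewrite s0 gt_eqF.
rewrite /action Kint (integral_EFin_period KI).
apply: (@le_trans _ _ ((2^-1)%:E * (period_integral K)%:E + (2^-1)%:E *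
   (\sum_(1 <= h < n) polygon_chord n r h `^ (- alpha) *
      (2 * pi * (1 + alpha / 2) - alpha / 2 / r ^+ 2 * E))%:E)%E).
  rewrite -!EFinM -EFinD lee_fin -mulr_suml -/(polygon_potential n alpha r).
  have := kin; set S := polygon_potential n alpha r in req *.
  have -> : (omega - 1) ^+ 2 = alpha / 2 * S / r ^+ 2.
    by rewrite -req mulfK// gt_eqF// exprn_gt0.
  move=> kin'; lra.
rewrite leeD2l// lee_wpmul2l ?lee_fin ?invr_ge0//.
rewrite -sumEFin big_nat_cond [leRHS]big_nat_cond; apply: lee_sum => h /andP[hn _].
exact: pot.
Qed.

(** * The circle *)

(** The curve r e^(-it).  It only has the mode j = -1, for which the kinetic bound and
    the chord inequality are equalities. *)
Definition circle {R : realType} (r t : R) : R[i] := (r * cos t +i* (- (r * sin t)))%C.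

Definition circle_velocity {R : realType} (r t : R) : R[i] :=
  (- (r * sin t) +i* (- (r * cos t)))%C.

Lemma is_derive_circle_Re (R : realType) (r t : R) :
  is_derive t 1 (fun t => r * cos t) (- (r * sin t)).
Proof. by rewrite -mulrN; apply: is_deriveZ. Qed.

Lemma is_derive_circle_Im (R : realType) (r t : R) :
  is_derive t 1 (fun t => - (r * sin t)) (- (r * cos t)).
Proof. by apply: is_deriveN; apply: is_deriveZ. Qed.

Lemma continuous_circle_Re (R : realType) (r : R) : continuous (fun t => r * cos t).
Proof. by apply: continuousZ_fun; exact: continuous_cos. Qed.

Lemma continuous_circle_Im (R : realType) (r : R) : continuous (fun t => - (r * sin t)).
Proof.
by move=> t; apply: cvgN; apply: (@continuousZ_fun R r sin); exact: continuous_sin.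
Qed.

Lemma weak_deriv_circle_Re (R : realType) (r : R) :
  weak_deriv (fun t => r * cos t) (fun t => - (r * sin t)).
Proof.
exact: weak_deriv_C1 (@is_derive_circle_Re R r) (@continuous_circle_Im R r).
Qed.

Lemma weak_deriv_circle_Im (R : realType) (r : R) :
  weak_deriv (fun t => - (r * sin t)) (fun t => - (r * cos t)).
Proof.
apply: weak_deriv_C1 (@is_derive_circle_Im R r) _ => t.
by apply: cvgN; exact: continuous_circle_Re.
Qed.

Lemma L2loc_continuous (R : realType) (y : R -> R[i]) :
  continuous (fun t => complex.Re (y t)) -> continuous (fun t => complex.Im (y t)) ->
  L2loc y.
Proof.
move=> ca cb; split; try exact: continuous_measurable_fun.
rewrite (_ : (fun t => _) = (fun t => complex.Re (y t) ^+ 2 + complex.Im (y t) ^+ 2)).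
  by apply: continuous_locally_integrable; apply: continuousD_fun; exact: sqr_continuous.
by apply/funext => t; rewrite normc_sqr.
Qed.

Lemma weak_derivative_circle (R : realType) (r : R) :
  is_weak_derivative (circle r) (circle_velocity r).
Proof.
have [_ l1 w1] := weak_deriv_circle_Re r; have [_ l2 w2] := weak_deriv_circle_Im r.
by split.
Qed.

Lemma periodic_circle (R : realType) (r : R) : periodic_with (2 * pi) (circle r).
Proof.
move=> t; have -> : 2 * pi = pi *+ 2 :> R by ring.
by rewrite /circle cosD2pi sinD2pi.
Qed.

Lemma H1_circle (R : realType) (r : R) : H1_2pi (circle r).
Proof.
split.
- exact: continuous_circle_Re.
- exact: continuous_circle_Im.
- exact: periodic_circle.
- by apply: L2loc_continuous; [exact: continuous_circle_Re|exact: continuous_circle_Im].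
- exists (circle_velocity r); first exact: weak_derivative_circle.
  apply: L2loc_continuous; first exact: continuous_circle_Im.
  by move=> t; apply: cvgN; exact: continuous_circle_Re.
Qed.

Lemma circle_chord (R : realType) (n h : nat) (r t : R) :
  (1 <= h < n)%N -> 0 < r ->
  normc (circle r t - circle r (t + h%:R * tau n)) = polygon_chord n r h.
Proof.
move=> hn r0; apply/eqP; rewrite -(@eqrXn2 _ 2) //; last 2 first.
- exact: normc_nonneg.
- by rewrite ltW// polygon_chord_gt0.
rewrite normc_diff /= /polygon_chord.
have nR : 0 < n%:R :> R by rewrite ltr0n; case/andP: hn => ? /(leq_trans _); apply.
set x := pi / n%:R * h%:R.
have -> : h%:R * tau n = x *+ 2 by rewrite /tau /x; field; rewrite gt_eqF.
rewrite cosD sinD cos_mulr2n sin_mulr2n.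
have h1 := sin2cos2 x; have h2 := sin2cos2 t.
set s := sin x in h1 *; set c := cos x in h1 *.
set S := sin t in h2 *; set C := cos t in h2 *.
apply/eqP; ring: h1 h2.
Qed.

Lemma Lambda_circle (R : realType) (n : nat) (r : R) : 0 < r -> Lambda n (circle r).
Proof.
move=> r0; split; first exact: H1_circle.
move=> t h hn E; have := circle_chord t hn r0.
rewrite -E subrr => /eqP; rewrite eq_sym.
by rewrite normc0 gt_eqF// polygon_chord_gt0.
Qed.

Lemma is_circle_circle (R : realType) (r : R) : 0 < r -> is_circle r (circle r).
Proof.
move=> r0; split=> //; exists 0, (-1), 0; split; first by rewrite oppr_eq0 oner_eq0.
move=> t; rewrite addr0 mulN1r add0r /circle /expi cosN sinN.
by apply/eqP; rewrite eq_complex /=; apply/andP; split; apply/eqP; ring.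
Qed.

Lemma minimal_period_circle (R : realType) (r : R) :
  0 < r -> minimal_period (2 * pi) (circle r).
Proof.
move=> r0; have pi0 := pi_gt0 R; split; first lra.
  exact: periodic_circle.
move=> S S0 /(_ 0); rewrite add0r /circle cos0 => -[+ _].
move=> /(mulfI (lt0r_neq0 r0)) c1; rewrite leNgt; apply/negP => S2.
have s0 : 0 < sin (S / 2) by rewrite sin_gt0_pi//; apply/andP; split; lra.
have : cos S = 1 - 2 * sin (S / 2) ^+ 2.
  have -> : cos S = cos ((S / 2) *+ 2) by congr cos; field.
  by rewrite cos_mulr2n cos2sin2; ring.
by rewrite c1; have := exprn_gt0 2 s0; lra.
Qed.

(** The derivative in the action is only determined almost everywhere, so it is first
    replaced by the classical one. *)
Lemma action_circle (R : realType) (n : nat) (alpha omega r : R) :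
  (2 <= n)%N -> 0 < r ->
  (omega - 1) ^+ 2 * r ^+ 2 = alpha / 2 * polygon_potential n alpha r ->
  action n alpha omega (circle r) =
    (pi * (1 + alpha / 2) * polygon_potential n alpha r)%:E.
Proof.
move=> n2 r0 req; set w := weak_derivative (circle r).
have [Lw w1 w2] : is_weak_derivative (circle r) w.
  apply: (@xgetPex _ _ [set v | is_weak_derivative (circle r) v]).
  by exists (circle_velocity r); exact: weak_derivative_circle.
have wa : weak_deriv (fun t => r * cos t) (fun t => complex.Re (w t)).
  by split=> //; [exact: continuous_circle_Re|case: Lw].
have wb : weak_deriv (fun t => - (r * sin t)) (fun t => complex.Im (w t)).
  by split=> //; [exact: continuous_circle_Im|case: Lw].
have uRe := weak_deriv_ae_unique wa (weak_deriv_circle_Re r).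
have uIm := weak_deriv_ae_unique wb (weak_deriv_circle_Im r).
have kin : (\int[lebesgue_measure]_(t in `[0%R, (2 * pi)%R])
       (normc (w t + 'i%C * (omega%:C)%C * circle r t) ^+ 2)%:E =
    ((omega - 1) ^+ 2 * r ^+ 2 * (2 * pi))%:E)%E.
  rewrite -integral_cst_period; apply: ae_eq_integral => //.
  - apply/measurable_EFinP; apply: measurable_funTS.
    rewrite (_ : (fun t => _) = (fun t =>
      (complex.Re (w t) - omega * - (r * sin t)) ^+ 2 +
      (complex.Im (w t) + omega * (r * cos t)) ^+ 2)).
      have [[mp _ _] [mq _ _]] := Lw.
      apply: measurable_funD; apply: measurable_funX.
        apply: measurable_funB => //; apply: continuous_measurable_fun.
        by apply: (@continuousZ_fun R omega); exact: continuous_circle_Im.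
      apply: measurable_funD => //; apply: continuous_measurable_fun.
      by apply: (@continuousZ_fun R omega); exact: continuous_circle_Re.
    by apply/funext => t; rewrite normc_rotating.
  - move: uRe uIm; apply: filterS2.
      exact: (ae_filter_ringOfSetsType (@lebesgue_measure R)).
    move=> t e1 e2 /=; rewrite in_itv /= => /andP[t0 _].
    have t1 : -1 < t by rewrite (lt_le_trans _ t0)// ltrN10.
    rewrite normc_rotating (e1 t1) (e2 t1) /=; congr (_%:E).
    have := sin2cos2 t; set s := sin t; set c := cos t => E; ring: E.
rewrite /action -/w kin.
have -> : (\sum_(1 <= h < n) \int[lebesgue_measure]_(t in `[0%R, (2 * pi)%R])
         (1 / (normc (circle r t - circle r (t + h%:R * tau n)) `^ alpha))%:E)%E =
   (polygon_potential n alpha r * (2 * pi))%:E.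
  rewrite /polygon_potential mulr_suml -sumEFin; apply: eq_big_nat => h hn.
  rewrite -integral_cst_period; apply: eq_integral => t _.
  by rewrite circle_chord// powRN div1r.
by rewrite -!EFinM -EFinD req; congr (_%:E); field.
Qed.

(** Comparing m = 1 with m = 2 in the definition of h(omega) already gives
    omega <= 4/3. *)
Lemma le_of_lt_omega_star (R : realType) (omega : R) :
  0 < omega -> omega < omega_star -> omega <= 4 / 3.
Proof.
move=> o0; rewrite /omega_star; case: xgetP => [w _ [[w0 hw] _] ow|_ ow]; last first.
  by have := lt_trans o0 ow; rewrite ltxx.
apply: le_trans (ltW ow) _.
move: hw; rewrite /hmin; case: xgetP => // m _ [[_ +] _] m1; rewrite m1 => H.
have : w * (3 * w - 4) <= 0.
  have -> : w * (3 * w - 4) = 4 * (hratio w 1 - hratio w 2).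
    by rewrite /hratio; field.
  by rewrite pmulr_rle0// subr_le0; exact: H.
by rewrite pmulr_rle0//; lra.
Qed.

Theorem theorem2 (R : realType) :
  exists rho : nat -> R -> R -> R,
  forall (n : nat) (alpha omega : R),
    (2 <= n)%N -> 0 < alpha ->
    0 < omega -> omega < omega_star -> omega <> 1 ->
    exists y : R -> R[i],
      [/\ Lambda n y,
          is_circle (rho n alpha omega) y,
          minimal_period (2 * pi) y &
          forall z : R -> R[i], Lambda n z ->
            (action n alpha omega y <= action n alpha omega z)%E].
Proof.
exists critical_radius => n alpha omega n2 alpha0 omega0 omega_lt omega1.
have r0 := critical_radius_gt0 n2 alpha0 omega1.
have req := critical_radiusP n2 alpha0 omega1.
exists (circle (critical_radius n alpha omega)); split.
- exact: Lambda_circle.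
- exact: is_circle_circle.
- exact: minimal_period_circle.
move=> z zL; rewrite (action_circle n2 r0 req).
exact: action_ge (le_of_lt_omega_star omega0 omega_lt) r0 req zL.
Qed.
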